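(* Let $\zeta$ be a geodesic curve on $M_1$ and let $(M_1,g_{M_1},\dot\zeta,\mu)$ be a Ricci soliton with potential vector field $\dot\zeta\in\Gamma(TM_1)$. Let $\vartheta:(M_1^{d_1},g_{M_1})\to(M_2^{d_2},g_{M_2})$ be a homothetic Clairaut conformal submersion with $r=e^{\beta}$ from the Riemannian manifold $M_1$ to an Einstein manifold $M_2$ such that the fibers of $\vartheta$ are totally geodesic and $(\ker\vartheta_* )^\perp$ is integrable. Then $\dot\zeta$ is a conformal vector field on $(\ker\vartheta_* )^\perp$.
   Context: $(M_1^{d_1},g_{M_1})$ and $(M_2^{d_2},g_{M_2})$ are Riemannian manifolds of dimensions $d_1,d_2$. A conformal submersion with dilation $\sigma$ is a smooth submersion $\vartheta:M_1\to M_2$ with a smooth function $\sigma:M_1\to\mathbb R^+$ such that $g_{M_2}(\vartheta_*X,\vartheta_*Y)=\sigma^2(p)g_{M_1}(X,Y)$ for all $p\in M_1$ and $X,Y\in(\ker\vartheta_{*p})^\perp$. Vectors in $\ker\vartheta_*$ are vertical, those in $(\ker\vartheta_* )^\perp$ horizontal. It is (horizontally) homothetic if the gradient of $\sigma$ is vertical, i.e. the horizontal part of $\mathrm{grad}\,\sigma$ is zero. A conformal submersion $\vartheta$ is a Clairaut conformal submersion with function $r:M_1\to\mathbb R^+$ if for every geodesic $\gamma$ of $M_1$ the function $s\mapsto r(\gamma(s))\sin\omega(s)$ is constant, where $\omega(s)$ is the angle between $\dot\gamma(s)$ and the horizontal space at $\gamma(s)$; here $r=e^\beta$ with $\beta$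 a smooth function on $M_1$. $(M,g,\xi,\mu)$, with $\xi$ a vector field on $M$ and $\mu$ a constant, is a Ricci soliton if $\frac12L_\xi g+Ric+\mu g=0$, where $L_\xi g$ is the Lie derivative and $Ric$ the Ricci tensor. Here $\dot\zeta$ denotes a vector field on $M_1$ which along $\zeta$ is the velocity field of $\zeta$. A vector field $\xi$ on $M_1$ is a conformal vector field on $(\ker\vartheta_* )^\perp$ if there is a smooth function $f$ on $M_1$ with $(L_\xi g_{M_1})(X_1,X_2)=2f\,g_{M_1}(X_1,X_2)$ for all $X_1,X_2\in\Gamma((\ker\vartheta_* )^\perp)$. *)

(* Defs.v *)
From HB Require Import structures.
From mathcomp Require Import all_boot all_order all_algebra.
From mathcomp Require Import all_classical all_reals all_analysis.

Set Implicit Arguments.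
Unset Strict Implicit.
Unset Printing Implicit Defensive.

Import Order.TTheory GRing.Theory Num.Theory.
Import numFieldNormedType.Exports.

Local Open Scope classical_set_scope.
Local Open Scope ring_scope.

(* f is (k+1) times Frechet differentiable on U, through iterated directional
   derivatives; only meaningful for U open. *)
Fixpoint diff_on (R : realType) (V W : normedModType R) (k : nat)
    (U : set V) (f : V -> W) : Prop :=
  (forall x, U x -> differentiable f x) /\
  (if k is k'.+1 then forall v, diff_on k' U (fun x => 'D_v f x) else True).

Definition smooth_on (R : realType) (V W : normedModType R)
    (U : set V) (f : V -> W) : Prop := forall k, diff_on k U f.

(* The atlas is indexed by the points of the manifold: each point p comes with
   a chosen chart [chart p] around it, with inverse [param p] (arbitrary outside
   [chart p @` chart_dom p]).  Any atlas can be re-indexed in this way, with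
   repetitions. *)
Record manifold (R : realType) (n : nat) := Manifold {
  carrier :> topologicalType ;
  manifold_hausdorff : hausdorff_space carrier ;
  manifold_second_countable : @second_countable carrier ;
  chart_dom : carrier -> set carrier ;
  chart : carrier -> carrier -> 'rV[R]_n ;
  param : carrier -> 'rV[R]_n -> carrier ;
  chart_dom_center : forall p, chart_dom p p ;
  chart_dom_open : forall p, open (chart_dom p) ;
  chart_img_open : forall p, open (chart p @` chart_dom p) ;
  chartK : forall p q, chart_dom p q -> param p (chart p q) = q ;
  chart_continuous : forall p q, chart_dom p q -> {for q, continuous (chart p)} ;
  param_continuous : forall p x, (chart p @` chart_dom p) x ->
    {for x, continuous (param p)} ;
  chart_compat : forall p q,
    smooth_on (chart p @` (chart_dom p `&` chart_dom q)) (chart q \o param p)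
}.

Definition chart_img (R : realType) (n : nat) (M : manifold R n) (p : M) :
  set 'rV[R]_n := chart p @` chart_dom p.

Definition smooth_into (R : realType) (V : normedModType R) (n : nat)
    (M : manifold R n) (U : set V) (F : V -> M) : Prop :=
  (forall x, U x -> {for x, continuous F}) /\
  (forall p : M, smooth_on (U `&` F @^-1` chart_dom p) (chart p \o F)).

Definition smooth_fun (R : realType) (n : nat) (M : manifold R n)
    (f : M -> R) : Prop :=
  forall p : M, smooth_on (chart_img p) (f \o param p).

Definition smooth_map (R : realType) (n m : nat) (M : manifold R n)
    (N : manifold R m) (F : M -> N) : Prop :=
  forall p : M, smooth_into (chart_img p) (F \o param p).

(* A tangent vector at p is the row vector of its components in the chosen chart
   at p, so all of the following pointwise data at p are components in [chart p].
   Linear maps act on row vectors from the right, as 'J does. *)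
Definition tmap (R : realType) (n m : nat) (M : manifold R n)
    (N : manifold R m) (F : M -> N) (p : M) : 'M[R]_(n, m) :=
  'J (chart (F p) \o F \o param p) (chart p p).

Definition vfield (R : realType) (n : nat) (M : manifold R n) : Type :=
  M -> 'rV[R]_n.

(* The components of X in the single chart at p, as a function of the
   coordinates: the components at q = param p x, which refer to the chart at q,
   are converted by the change of coordinates. *)
Definition vf_in (R : realType) (n : nat) (M : manifold R n) (X : vfield M)
    (p : M) (x : 'rV[R]_n) : 'rV[R]_n :=
  let q := param p x in X q *m 'J (chart p \o param q) (chart q q).

Definition smooth_vf_on (R : realType) (n : nat) (M : manifold R n)
    (O : set M) (X : vfield M) : Prop :=
  forall p : M, smooth_on (chart p @` (O `&` chart_dom p)) (vf_in X p).

(* The Gram matrix, in the coordinates of the chart at p, of the field of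
   bilinear forms g. *)
Definition form_in (R : realType) (n : nat) (M : manifold R n)
    (g : M -> 'M[R]_n) (p : M) (x : 'rV[R]_n) : 'M[R]_n :=
  let q := param p x in
  let A := 'J (chart q \o param p) x in
  A *m g q *m A^T.

Definition bilin (R : realType) (n : nat) (B : 'M[R]_n) (u v : 'rV[R]_n) : R :=
  (u *m B *m v^T) 0 0.

Record metric (R : realType) (n : nat) (M : manifold R n) := Metric {
  gram :> M -> 'M[R]_n ;
  gram_sym : forall p, (gram p)^T = gram p ;
  gram_pos : forall p (v : 'rV[R]_n), v != 0 -> 0 < bilin (gram p) v v ;
  gram_smooth : forall p : M, smooth_on (chart_img p) (form_in gram p)
}.

Definition tnorm (R : realType) (n : nat) (M : manifold R n) (g : metric M)
    (p : M) (u : 'rV[R]_n) : R := Num.sqrt (bilin (g p) u u).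

Definition pd (R : realType) (n : nat) (i : 'I_n) (f : 'rV[R]_n -> R)
    (x : 'rV[R]_n) : R := 'D_(delta_mx 0 i) f x.

Definition grad (R : realType) (n : nat) (M : manifold R n) (g : metric M)
    (f : M -> R) (p : M) : 'rV[R]_n :=
  (\row_i pd i (f \o param p) (chart p p)) *m invmx (g p).

(* Gamma^k_ij of the Levi-Civita connection of a metric given in coordinates. *)
Definition christoffel (R : realType) (n : nat) (G : 'rV[R]_n -> 'M[R]_n)
    (k i j : 'I_n) (x : 'rV[R]_n) : R :=
  2^-1 * \sum_l invmx (G x) k l *
    (pd i (fun y => G y j l) x + pd j (fun y => G y i l) x
     - pd l (fun y => G y i j) x).

(* The coefficient of d_l in R(d_i, d_j) d_k, where
   R(X, Y) Z = nabla_X nabla_Y Z - nabla_Y nabla_X Z - nabla_[X, Y] Z. *)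
Definition riemann (R : realType) (n : nat) (G : 'rV[R]_n -> 'M[R]_n)
    (l k i j : 'I_n) (x : 'rV[R]_n) : R :=
  pd i (christoffel G l j k) x - pd j (christoffel G l i k) x
  + \sum_m (christoffel G l i m x * christoffel G m j k x
            - christoffel G l j m x * christoffel G m i k x).

(* Ric(Y, Z) is the trace of X |-> R(X, Y) Z. *)
Definition ricci (R : realType) (n : nat) (M : manifold R n) (g : metric M)
    (p : M) : 'M[R]_n :=
  \matrix_(j, k) \sum_i riemann (form_in g p) i k i j (chart p p).

Definition gamma_term (R : realType) (n : nat) (M : manifold R n)
    (g : metric M) (p : M) (u v : 'rV[R]_n) : 'rV[R]_n :=
  \row_k \sum_i \sum_j christoffel (form_in g p) k i j (chart p p)
                       * u 0 i * v 0 j.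

Definition nabla (R : realType) (n : nat) (M : manifold R n) (g : metric M)
    (X Y : vfield M) : vfield M :=
  fun p => 'D_(X p) (vf_in Y p) (chart p p) + gamma_term g p (X p) (Y p).

(* (L_xi g)_ij = xi^k d_k g_ij + g_kj d_i xi^k + g_ik d_j xi^k. *)
Definition lie_metric (R : realType) (n : nat) (M : manifold R n)
    (xi : vfield M) (g : metric M) (p : M) : 'M[R]_n :=
  let D := 'J (vf_in xi p) (chart p p) in
  'D_(xi p) (form_in g p) (chart p p) + D *m g p + g p *m D^T.

Definition ricci_soliton (R : realType) (n : nat) (M : manifold R n)
    (g : metric M) (xi : vfield M) (mu : R) : Prop :=
  smooth_vf_on setT xi /\
  forall p, 2^-1 *: lie_metric xi g p + ricci g p + mu *: g p = 0.

Definition einstein (R : realType) (n : nat) (M : manifold R n)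
    (g : metric M) : Prop :=
  exists lambda : R, forall p, ricci g p = lambda *: g p.

Definition velocity (R : realType) (n : nat) (M : manifold R n)
    (c : R -> M) (s : R) : 'rV[R]_n := derive1 (chart (c s) \o c) s.

Definition geodesic (R : realType) (n : nat) (M : manifold R n)
    (g : metric M) (J : set R) (c : R -> M) : Prop :=
  [/\ open J, is_interval J, J !=set0, smooth_into J c &
      forall s, J s -> derive1n 2 (chart (c s) \o c) s
        + gamma_term g (c s) (velocity c s) (velocity c s) = 0].

Definition vertical (R : realType) (n m : nat) (M : manifold R n)
    (N : manifold R m) (theta : M -> N) (p : M) (u : 'rV[R]_n) : Prop :=
  u *m tmap theta p = 0.

Definition horizontal (R : realType) (n m : nat) (M : manifold R n)
    (N : manifold R m) (g : metric M) (theta : M -> N) (p : M)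
    (u : 'rV[R]_n) : Prop :=
  forall v, vertical theta p v -> bilin (g p) u v = 0.

Definition submersion (R : realType) (n m : nat) (M : manifold R n)
    (N : manifold R m) (theta : M -> N) : Prop :=
  smooth_map theta /\ forall p, row_full (tmap theta p).

Definition conformal_submersion (R : realType) (n m : nat) (M : manifold R n)
    (N : manifold R m) (g : metric M) (h : metric N) (theta : M -> N)
    (sigma : M -> R) : Prop :=
  [/\ submersion theta, smooth_fun sigma, forall p, 0 < sigma p &
      forall p u v, horizontal g theta p u -> horizontal g theta p v ->
        bilin (h (theta p)) (u *m tmap theta p) (v *m tmap theta p)
        = sigma p ^+ 2 * bilin (g p) u v].

Definition homothetic (R : realType) (n m : nat) (M : manifold R n)
    (N : manifold R m) (g : metric M) (theta : M -> N) (sigma : M -> R) :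
  Prop := forall p, vertical theta p (grad g sigma p).

(* omega is the angle in [0, pi/2] between u and the horizontal space, that is,
   between u and its orthogonal projection w. *)
Definition horizontal_angle (R : realType) (n m : nat) (M : manifold R n)
    (N : manifold R m) (g : metric M) (theta : M -> N) (p : M)
    (u : 'rV[R]_n) (omega : R) : Prop :=
  0 <= omega <= pi / 2 /\
  exists w, [/\ horizontal g theta p w, vertical theta p (u - w) &
                tnorm g p w = tnorm g p u * cos omega].

(* Constant geodesics are left out: the angle is undefined for a zero
   velocity. *)
Definition clairaut (R : realType) (n m : nat) (M : manifold R n)
    (N : manifold R m) (g : metric M) (theta : M -> N) (r : M -> R) : Prop :=
  forall (J : set R) (c : R -> M) (omega : R -> R),
    geodesic g J c ->
    (forall s, J s -> velocity c s != 0) ->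
    (forall s, J s ->
      horizontal_angle g theta (c s) (velocity c s) (omega s)) ->
    forall s t, J s -> J t ->
      r (c s) * sin (omega s) = r (c t) * sin (omega t).

(* Vanishing of the second fundamental form of the fibers, computed with
   arbitrary local vertical extensions. *)
Definition totally_geodesic_fibers (R : realType) (n m : nat)
    (M : manifold R n) (N : manifold R m) (g : metric M) (theta : M -> N) :
  Prop :=
  forall (O : set M) (U V : vfield M),
    open O -> smooth_vf_on O U -> smooth_vf_on O V ->
    (forall p, O p -> vertical theta p (U p)) ->
    (forall p, O p -> vertical theta p (V p)) ->
    forall p, O p -> vertical theta p (nabla g U V p).

(* Every point lies on an integral manifold of the horizontal distribution,
   given by a parametrization F. *)
Definition horizontal_integrable (R : realType) (n m : nat)
    (M : manifold R n) (N : manifold R m) (g : metric M) (theta : M -> N) :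
  Prop :=
  forall p : M, exists (W : set 'rV[R]_m) (F : 'rV[R]_m -> M),
    [/\ open W, smooth_into W F, exists2 x, W x & F x = p &
        forall x, W x ->
          let D := 'J (chart (F x) \o F) x in
          row_free D /\
          forall u, horizontal g theta (F x) u <-> exists a, u = a *m D].

Definition conformal_on_horizontal (R : realType) (n m : nat)
    (M : manifold R n) (N : manifold R m) (g : metric M) (theta : M -> N)
    (xi : vfield M) : Prop :=
  exists f : M -> R, smooth_fun f /\
    forall X1 X2 : vfield M,
      smooth_vf_on setT X1 -> smooth_vf_on setT X2 ->
      (forall p, horizontal g theta p (X1 p)) ->
      (forall p, horizontal g theta p (X2 p)) ->
      forall p, bilin (lie_metric xi g p) (X1 p) (X2 p)
                = 2 * f p * bilin (g p) (X1 p) (X2 p).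

(* Main.v *)
Require Import Defs.
From HB Require Import structures.
From mathcomp Require Import all_boot all_order all_algebra.
From mathcomp Require Import all_classical all_reals all_analysis.
From mathcomp Require Import ring lra.
Import Order.TTheory GRing.Theory Num.Theory.
Import numFieldNormedType.Exports.
Local Open Scope classical_set_scope.
Local Open Scope ring_scope.

Set Implicit Arguments.
Unset Strict Implicit.
Unset Printing Implicit Defensive.

(** Write [alpha] for the differential of [ln sigma].  Locally the total space
is a warped product: the leaves of the horizontal distribution carry the metric
of the base divided by [sigma ^ 2], [sigma] is constant along these leaves, and
the metric of the fibers does not depend on the leaf.  For such a product the
Ricci tensor of the total space, restricted to horizontal vectors, differs from
that of the base by a multiple of the metric.  As the base is Einstein,
  [Ric (u, v) = (Delta (ln sigma) + lambda * sigma ^ 2) * g (u, v)]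
for [v] horizontal, and the soliton equation turns this into
[L_xi g = 2 f g] on horizontal vectors, with
[f = - (Delta (ln sigma) + lambda * sigma ^ 2 + mu)].

No product coordinates are constructed.  Everything is read off the covariant
Hessian of [theta] in a pair of fixed charts, which has to be
  [nabla_i nabla_j theta^a = alpha_i d_j theta^a + alpha_j d_i theta^a
     - Gamma^a_bc (theta) d_i theta^b d_j theta^c]   (lemma [hess_eq_model]).
Indeed the difference [D] of the two sides is a symmetric bilinear form with
values in the tangent space of the base.  Conformality says that the gradients
of the components of [theta] have Gram matrix [sigma ^ 2] times the inverse
metric of the base, and the covariant derivative of this identity makes [D]
skew when its value is paired with a horizontal argument.  Hence [D] vanishes
on horizontal vectors, by the argument that makes the Levi-Civita connection
unique.  On pairs of vertical vectors it vanishes because the fibers are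
totally geodesic ([rep_fibers]).  On mixed pairs integrability makes a skew
form symmetric ([integrable_mixed], [rep_integrable]).  The linear algebra is
[second_form_eq0].

Knowing their first covariant derivatives, one commutes the second covariant
derivatives of the gradients of the components of [theta].  The Ricci identity
then yields the curvature of the total space on these gradients
([lift_curvature]), and its trace is the formula for [Ric] ([lift_ricci_mx],
[ricci_horizontal]): the terms in the square of the norm of [alpha] cancel, and
the curvature of the base contributes its Ricci tensor.

The function [f] is defined point by point in the chart centered at each
point, so its smoothness requires that the Laplacian of [ln sigma] does not
depend on the chart.  A transition map is a conformal submersion of dilation 1
without vertical vectors; for it [hess_eq_model] is the transformation law of
the Christoffel symbols ([christoffel_law]), from which this independence
follows ([log_laplacian_isometry]).  The same law carries the condition on the
fibers, given at each point in its own chart, to a fixed chart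
([hess_change]).

Row vectors hold the components of tangent vectors, so that linear maps and
connection matrices act from the right. *)

(** * Iterated differentiability and the symmetry of second derivatives *)

Section Calculus.
Variable R : realType.
Implicit Types V W : normedModType R.

Lemma near_eq_diff V W (f g : V -> W) (x : V) :
  (\near x, f x = g x) -> differentiable f x ->
  differentiable g x /\ 'd g x = 'd f x :> (V -> W).
Proof.
move=> fg df.
have fgx : f x = g x by exact: nbhs_singleton fg.
have e : g \o shift x = cst (g x) + 'd f x +o_ 0 id.
  apply/eqaddoP => /= eps eps0.
  have := diff_locally df => /eqaddoP /(_ eps eps0) H.
  have H2 : \forall h \near 0, f (h + x) = g (h + x).
    by move: fg; rewrite (near_shift 0) /= subr0.
  near=> h.
  have -> : (g \o shift x - (cst (g x) + 'd f x)) h =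
            (f \o shift x - (cst (f x) + 'd f x)) h.
    by rewrite /= -[in LHS]fgx !fctE /= (near H2 h).
  exact: (near H h).
have d : 'd g x = 'd f x :> (V -> W).
  by apply: (@diff_unique _ _ _ g ('d f x) x _ e); apply: diff_continuous.
split=> //; apply/diff_locallyP; rewrite d; split => //.
exact: diff_continuous.
Unshelve. all: by end_near. Qed.

Lemma open_eq_near V (T : Type) (U : set V) (f g : V -> T) x :
  open U -> U x -> (forall y, U y -> f y = g y) -> \near x, f x = g x.
Proof.
by move=> oU Ux fg; near=> y; apply: fg; near: y; exact: open_nbhs_nbhs.
Unshelve. all: by end_near. Qed.

Lemma diff_mxE V a b (A : V -> 'M[R]_(a, b)) x k l : differentiable A x ->
  differentiable (fun y => A y k l) x /\
  forall v, 'd (fun y => A y k l) x v = ('d A x v) k l.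
Proof.
move=> dA.
have @f : {linear 'M[R]_(a, b) -> R}.
  by exists (fun N : 'M[R]_(_, _) => N k l); do 2![eexists]; do ?[constructor];
     rewrite ?mxE// => ? *; rewrite ?mxE//; move=> ?; rewrite !mxE.
have cf : continuous f by exact: coord_continuous.
have df : differentiable f (A x) by exact: linear_differentiable.
split; first exact: (differentiable_comp dA df).
move=> v; rewrite (_ : (fun y => A y k l) = f \o A)// (diff_comp dA df) /=.
by rewrite [X in X ('d A x v)](diff_lin (A x) cf).
Qed.

Lemma differentiable_mxP V a b (A : V -> 'M[R]_(a, b)) x :
  (forall k l, differentiable (fun y => A y k l) x) -> differentiable A x.
Proof.
move=> dA.
have -> : A = \sum_(k < a) \sum_(l < b) (fun y => A y k l *: delta_mx k l).
  apply/funext => y; rewrite [LHS]matrix_sum_delta fct_sumE.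
  by apply: eq_bigr => k _; rewrite fct_sumE.
apply: differentiable_sum => k; apply: differentiable_sum => l.
exact: differentiableZl.
Qed.

Lemma derive_mxE V a b (A : V -> 'M[R]_(a, b)) x v k l : differentiable A x ->
  ('D_v A x) k l = 'D_v (fun y => A y k l) x.
Proof.
by move=> dA; have [d e] := diff_mxE k l dA; rewrite !deriveE// e.
Qed.

Lemma diff_on_differentiable V W k (U : set V) (f : V -> W) x :
  diff_on k U f -> U x -> differentiable f x.
Proof. by case: k => [|k] [df _]; exact: df. Qed.

Lemma diff_onW V W k (U : set V) (f : V -> W) :
  diff_on k.+1 U f -> diff_on k U f.
Proof.
elim: k f => [|k IH] f [df Df]; first by split.
by split=> // v; exact: IH.
Qed.

Lemma diff_on_subset V W k (U U' : set V) (f : V -> W) :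
  U' `<=` U -> diff_on k U f -> diff_on k U' f.
Proof.
move=> sU; elim: k f => [|k IH] f [df Df]; split=> //.
- by move=> x /sU; exact: df.
- by move=> x /sU; exact: df.
- by move=> v; exact/IH/Df.
Qed.

Lemma diff_on_eq V W k (U : set V) (f g : V -> W) : open U ->
  (forall x, U x -> f x = g x) -> diff_on k U f -> diff_on k U g.
Proof.
move=> oU; elim: k f g => [|k IH] f g fg [df Df].
  by split=> // x Ux; apply: (near_eq_diff _ (df x Ux)).1;
    exact: open_eq_near fg.
split; first by move=> x Ux;
  apply: (near_eq_diff _ (df x Ux)).1; exact: open_eq_near fg.
move=> v; apply: IH (Df v) => x Ux; apply: near_eq_derive.
exact: open_eq_near fg.
Qed.

Lemma diff_on_cst V W k (U : set V) (c : W) : diff_on k U (fun=> c).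
Proof.
elim: k c => [|k IH] c; split=> //; try by move=> x _;
  exact: differentiable_cst.
move=> v; have -> : (fun x => 'D_v (fun=> c) x) = (fun=> 0 : W).
  by apply/funext => x; exact: derive_cst.
exact: IH.
Qed.

Lemma diff_onD V W k (U : set V) (f g : V -> W) : open U ->
  diff_on k U f -> diff_on k U g -> diff_on k U (fun x => f x + g x).
Proof.
move=> oU; elim: k f g => [|k IH] f g [df Df] [dg Dg].
  by split=> // x Ux; apply: differentiableD; [exact: df|exact: dg].
split=> [x Ux|v]; first by apply: differentiableD; [exact: df|exact: dg].
apply: (diff_on_eq oU _ (IH _ _ (Df v) (Dg v))) => x Ux.
by rewrite -deriveD//; apply: diff_derivable; [exact: df|exact: dg].
Qed.

Lemma diff_onM V k (U : set V) (f g : V -> R) : open U ->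
  diff_on k U f -> diff_on k U g -> diff_on k U (fun x => f x * g x).
Proof.
move=> oU; elim: k f g => [|k IH] f g Sf Sg.
  by split=> // x Ux; apply: differentiableM;
    [exact: diff_on_differentiable Sf Ux|exact: diff_on_differentiable Sg Ux].
have [df Df] := Sf; have [dg Dg] := Sg.
split=> [x Ux|v]; first by apply: differentiableM; [exact: df|exact: dg].
apply: (diff_on_eq oU _ (diff_onD oU (IH _ _ (diff_onW Sf) (Dg v))
                           (IH _ _ (diff_onW Sg) (Df v)))) => x Ux.
by rewrite -[RHS]/('D_v (f * g) x) deriveM//; apply: diff_derivable;
  [exact: df|exact: dg].
Qed.

Lemma diff_onN V k (U : set V) (f : V -> R) : open U ->
  diff_on k U f -> diff_on k U (fun x => - f x).
Proof.
move=> oU Sf; apply: (diff_on_eq oU _ (diff_onM oU (diff_on_cst k U (-1 : R))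
  Sf)).
by move=> x _; rewrite mulN1r.
Qed.

Lemma diff_on_sum V k (U : set V) (I : Type) (r : seq I) (f : I -> V -> R) :
  open U -> (forall i, diff_on k U (f i)) ->
  diff_on k U (fun x => \sum_(i <- r) f i x).
Proof.
move=> oU Sf; elim: r => [|i r IH].
  by apply: (diff_on_eq oU _ (diff_on_cst k U (0 : R))) => x _; rewrite big_nil.
apply: (diff_on_eq oU _ (diff_onD oU (Sf i) IH)) => x _.
by rewrite big_cons.
Qed.

Lemma diff_on_prod V k (U : set V) (I : Type) (r : seq I) (f : I -> V -> R) :
  open U -> (forall i, diff_on k U (f i)) ->
  diff_on k U (fun x => \prod_(i <- r) f i x).
Proof.
move=> oU Sf; elim: r => [|i r IH].
  by apply: (diff_on_eq oU _ (diff_on_cst k U (1 : R))) => x _; rewrite big_nil.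
apply: (diff_on_eq oU _ (diff_onM oU (Sf i) IH)) => x _.
by rewrite big_cons.
Qed.

Lemma diff_onV V k (U : set V) (f : V -> R) : open U ->
  (forall x, U x -> f x != 0) ->
  diff_on k U f -> diff_on k U (fun x => (f x)^-1).
Proof.
move=> oU f0; elim: k f f0 => [|k IH] f f0 Sf.
  by split=> // x Ux; apply: differentiableV;
    [exact: diff_on_differentiable Sf Ux|exact: f0].
have [df Df] := Sf.
split=> [x Ux|v]; first by apply: differentiableV; [exact: df|exact: f0].
have SV := IH _ f0 (diff_onW Sf).
apply: (diff_on_eq oU _ (diff_onN oU (diff_onM oU (diff_onM oU SV SV) (Df v)))).
move=> x Ux; rewrite -[RHS]/('D_v (fun y => (f y)^-1) x) deriveV; last 2 first.
- exact: f0.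
- by apply: diff_derivable; exact: df.
by rewrite scaleNr expr2 invfM.
Qed.

Lemma diff_on_mxP V k (U : set V) a b (A : V -> 'M[R]_(a, b)) : open U ->
  diff_on k U A <-> forall i j, diff_on k U (fun x => A x i j).
Proof.
move=> oU; split.
  move=> SA i j; elim: k A SA => [|k IH] A [dA DA].
    by split=> // x Ux; apply: (diff_mxE _ _ _).1; exact: dA.
  split=> [x Ux|v]; first by apply: (diff_mxE _ _ _).1; exact: dA.
  apply: (diff_on_eq oU _ (IH _ (DA v))) => x Ux.
  by rewrite derive_mxE//; exact: dA.
elim: k A => [|k IH] A SA.
  split=> // x Ux; apply: differentiable_mxP => i j.
  exact: diff_on_differentiable (SA i j) Ux.
have dA x : U x -> differentiable A x.
  move=> Ux; apply: differentiable_mxP => i j.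
  exact: diff_on_differentiable (SA i j) Ux.
split=> // v; apply: IH => i j.
apply: (diff_on_eq oU _ ((SA i j).2 v)) => x Ux.
by rewrite derive_mxE//; exact: dA.
Qed.

Lemma derive_comp_rV V m W (f : 'rV[R]_m -> W) (psi : V -> 'rV[R]_m) x v :
  differentiable psi x -> differentiable f (psi x) ->
  'D_v (f \o psi) x =
    \sum_b ('D_v psi x) 0 b *: 'D_(delta_mx 0 b) f (psi x).
Proof.
move=> dpsi df; rewrite deriveE; last exact: differentiable_comp.
rewrite diff_comp//= -(deriveE v dpsi) {1}(row_sum_delta ('D_v psi x)).
rewrite linear_sum; apply: eq_bigr => b _.
by rewrite linearZ (deriveE _ df).
Qed.

(** By the chain rule each directional derivative of the composite is a sum of
products of a derivative of [psi] and a composite of lower order, so the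
induction has to range over all [f]. *)
Lemma diff_on_comp V m k (U : set V) (U' : set 'rV[R]_m) (f : 'rV[R]_m -> R)
    (psi : V -> 'rV[R]_m) : open U ->
  (forall x, U x -> U' (psi x)) -> diff_on k U psi -> diff_on k U' f ->
  diff_on k U (f \o psi).
Proof.
move=> oU UU'; elim: k f => [|k IH] f Sp Sf.
  split=> // x Ux; apply: differentiable_comp.
    exact: diff_on_differentiable Sp Ux.
  exact: diff_on_differentiable Sf (UU' _ Ux).
have [dp Dp] := Sp; have [df Df] := Sf.
split=> [x Ux|v].
  by apply: differentiable_comp; [exact: dp|exact/df/UU'].
have S b : diff_on k U (fun x => ('D_v psi x) 0 b *
    ('D_(delta_mx 0 b) f \o psi) x).
  apply: diff_onM => //; last by apply: IH; [exact: diff_onW|exact: Df].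
  by have [H _] := diff_on_mxP k (fun x => 'D_v psi x) oU; exact: H (Dp v) _ _.
apply: (diff_on_eq oU _ (diff_on_sum _ oU S)) => x Ux.
by rewrite derive_comp_rV//; [exact: dp|exact/df/UU'].
Qed.

Lemma is_derive_line V W (f : V -> W) (a u : V) (s : R) :
  differentiable f (a + s *: u) ->
  is_derive s 1 (fun t => f (a + t *: u)) ('D_u f (a + s *: u)).
Proof.
move=> /diff_derivable - /(_ u); rewrite /derivable /derive => H.
have E : (fun h : R => h^-1 *: (((fun t => f (a + t *: u)) \o shift s) (h *: 1)
    - f (a + s *: u))) =
    (fun h => h^-1 *: ((f \o shift (a + s *: u)) (h *: u) - f (a + s *: u))).
  apply/funext => h /=; congr (_ *: (f _ - _)).
  by rewrite [h *: 1]mulr1 scalerDl addrCA.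
by apply: DeriveDef; rewrite /derivable /derive E.
Qed.

Lemma differentiable_expansion V (g : V -> R) x (e : R) : 0 < e ->
  differentiable g x ->
  exists2 d, 0 < d & forall w, `|w| < d ->
    `|g (x + w) - g x - 'd g x w| <= e * `|w|.
Proof.
move=> e0 dg; have := diff_locally dg => /eqaddoP /(_ e e0) /nbhs_ballP[d /=
  d0 H].
exists d => // w wd; have := H w; rewrite -ball_normE /= sub0r normrN =>
  /(_ wd).
by rewrite !fctE /= opprD addrA [w + x]addrC.
Qed.

Lemma second_difference_identity (a1 a2 a3 b D h c : R) :
  (a1 - a2) * h - h ^+ 2 * D =
  h * ((a1 - a3 - (c * b + h * D)) - (a2 - a3 - c * b)).
Proof. by ring. Qed.

(** The mean value theorem in the direction [u] turns the second difference
into [h] times an increment of ['D_u f], which is controlled by the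
differentiability of ['D_u f] at [x] alone. *)
Lemma second_difference V (f : V -> R) (U : set V) x u v (e : R) :
  open U -> U x -> 0 < e -> (forall y, U y -> differentiable f y) ->
  differentiable (fun y => 'D_u f y) x ->
  exists2 d, 0 < d & forall h, 0 < h < d ->
    `|f (x + h *: u + h *: v) - f (x + h *: u) - f (x + h *: v) + f x
      - h ^+ 2 * 'D_v (fun y => 'D_u f y) x| <= e * h ^+ 2.
Proof.
move=> oU Ux e0 df dg; set g := fun y => 'D_u f y.
(* All the points used below lie within h * K of x; the summand 1 keeps K
   positive when u and v vanish. *)
set K : R := 2 * (`|u| + `|v|) + 1.
have K0 : 0 < K by rewrite /K; have := normr_ge0 u; have := normr_ge0 v; lra.
have [d1 d10 H1] := differentiable_expansion (divr_gt0 e0 K0) dg.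
have /nbhs_ballP[d2 /= d20 H2] : nbhs x U by exact: open_nbhs_nbhs.
have d0 : 0 < Num.min d1 d2 / K by rewrite divr_gt0// lt_min d10.
exists (Num.min d1 d2 / K) => // h /andP[h0 hd].
have hK : h * K < Num.min d1 d2 by rewrite -ltr_pdivlMr.
have small s t : 0 <= s <= h -> 0 <= t <= h ->
    `|s *: u + t *: v| <= h * (`|u| + `|v|).
  move=> /andP[s0 sh] /andP[t0 th]; apply: le_trans (ler_normD _ _) _.
  rewrite !normrZ (ger0_norm s0) (ger0_norm t0) mulrDr.
  by apply: lerD; apply: ler_wpM2r.
have hK' : h * (`|u| + `|v|) <= h * K.
  rewrite ler_pM2l// /K; have := normr_ge0 u; have := normr_ge0 v; lra.
have inU s t : 0 <= s <= h -> 0 <= t <= h -> U (x + s *: u + t *: v).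
  move=> hs ht; apply: H2; rewrite -ball_normE /=
    -addrA opprD addrA subrr sub0r normrN.
  apply: le_lt_trans (small _ _ hs ht) _; apply: le_lt_trans hK' _.
  by apply: lt_le_trans hK _; rewrite ge_min lexx orbT.
pose phi s := f (x + h *: v + s *: u) - f (x + s *: u).
have hh : (0 : R) <= h <= h by rewrite lexx ltW.
have h00 : (0 : R) <= 0 <= h by rewrite lexx ltW.
have dphi s : 0 <= s <= h ->
    is_derive s 1 phi (g (x + h *: v + s *: u) - g (x + s *: u)).
  move=> hs; apply: is_deriveB; apply: is_derive_line; apply: df.
    by rewrite addrAC; exact: inU.
  by have := inU _ _ hs h00; rewrite scale0r addr0.
have [c ch] : exists2 c, c \in `]0, h[%R & phi h - phi 0 =
    (g (x + h *: v + c *: u) - g (x + c *: u)) * (h - 0).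
  apply: MVT => // [s /[!in_itv] /= /andP[s0 sh]|].
    by apply: dphi; rewrite !ltW.
  apply: derivable_within_continuous => s /[!in_itv] /= hs.
  by have [] := dphi _ hs.
rewrite subr0 => E.
have hc : 0 <= c <= h by move: ch; rewrite in_itv /= => /andP[? ?];
  rewrite !ltW.
have -> : f (x + h *: u + h *: v) - f (x + h *: u) - f (x + h *: v) + f x =
   phi h - phi 0.
  by rewrite /phi !scale0r !addr0 [x + h *: v + _]addrAC; ring.
rewrite {}E.
have lt1 s t : 0 <= s <= h -> 0 <= t <= h -> `|s *: u + t *: v| < d1.
  move=> hs ht; apply: le_lt_trans (small _ _ hs ht) _;
    apply: le_lt_trans hK' _.
  by apply: lt_le_trans hK _; rewrite ge_min lexx.
have A1 := H1 _ (lt1 _ _ hc hh).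
have A2 := H1 _ (lt1 _ _ hc h00).
have S1 := small _ _ hc hh; have S2 := small _ _ hc h00.
have eK0 : 0 < e / K by exact: divr_gt0.
pose b : R := 'd g x u; pose D : R := 'D_v g x.
have B1 : `|g (x + h *: v + c *: u) - g x - (c * b + h * D)| <=
    e / K * (h * (`|u| + `|v|)).
  have -> : c * b + h * D = 'd g x (c *: u + h *: v).
    by rewrite linearD 2!linearZ /D (deriveE v dg).
  rewrite [x + h *: v + _]addrAC -[x + c *: u + _]addrA.
  exact: le_trans A1 (ler_wpM2l (ltW eK0) S1).
have B2 : `|g (x + c *: u) - g x - c * b| <= e / K * (h * (`|u| + `|v|)).
  have -> : c * b = 'd g x (c *: u) by rewrite linearZ.
  by move: A2 S2; rewrite scale0r addr0 => A2 S2;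
    exact: le_trans A2 (ler_wpM2l (ltW eK0) S2).
rewrite -/D (second_difference_identity _ _ (g x) b _ _ c).
rewrite normrM (gtr0_norm h0) expr2 mulrCA ler_pM2l//.
apply: le_trans (ler_normB _ _) _; apply: le_trans (lerD B1 B2) _.
have -> : e / K * (h * (`|u| + `|v|)) + e / K * (h * (`|u| + `|v|)) =
   e * h * ((K - 1) / K) by rewrite /K; ring.
rewrite ler_piMr ?mulr_ge0 ?ltW// ltr_pdivrMr// mul1r; lra.
Qed.

(** Divided by [h ^+ 2], the second difference tends to both iterated
derivatives, as it is symmetric in [u] and [v]. *)
Lemma derive_commute V (f : V -> R) (U : set V) x u v :
  open U -> U x -> diff_on 1 U f ->
  'D_u (fun y => 'D_v f y) x = 'D_v (fun y => 'D_u f y) x.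
Proof.
move=> oU Ux [df Df].
apply/eqP; rewrite -subr_eq0 -normr_le0; apply/ler_addgt0Pr => e e0.
rewrite add0r; have e20 : 0 < e / 2 by rewrite divr_gt0.
have [d1 d10 H1] := second_difference v oU Ux e20 df ((Df u).1 _ Ux).
have [d2 d20 H2] := second_difference u oU Ux e20 df ((Df v).1 _ Ux).
set h := Num.min d1 d2 / 2.
have m0 : 0 < Num.min d1 d2 by rewrite lt_min d10.
have h0 : 0 < h by rewrite divr_gt0.
have hm : h < Num.min d1 d2 by rewrite /h; lra.
move: hm; rewrite lt_min => /andP[hd1 hd2].
have := H1 h; have := H2 h; rewrite h0 hd1 hd2 => /(_ isT) A /(_ isT) B.
have h20 : 0 < h ^+ 2 by rewrite exprn_gt0.
rewrite -(ler_pM2l h20) -{1}(gtr0_norm h20) -normrM.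
move: A B; rewrite [x + h *: v + h *: u]addrAC.
set p := f _; set q := f _; set r := f _; set s := f x.
set X := 'D_u _ x; set Y := 'D_v _ x => A B.
have -> : h ^+ 2 * (X - Y) = (p - r - q + s - h ^+ 2 * Y) - (p - q - r + s
  - h ^+ 2 * X).
  by ring.
apply: le_trans (ler_normB _ _) _; apply: le_trans (lerD B A) _.
by rewrite -mulrDl -splitr mulrC.
Qed.

End Calculus.

(** * Smooth matrix-valued functions *)

Section MatrixCalculus.
Variable R : realType.
Implicit Types V W : normedModType R.

Lemma differentiable_entry V a b (A : V -> 'M[R]_(a, b)) x k l :
  differentiable A x -> differentiable (fun y => A y k l) x.
Proof. by move=> dA; exact: (diff_mxE k l dA).1. Qed.

Lemma differentiable_mulmx V a b c (A : V -> 'M[R]_(a, b))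
    (B : V -> 'M[R]_(b, c)) x :
  differentiable A x -> differentiable B x ->
  differentiable (fun y => A y *m B y) x.
Proof.
move=> dA dB; apply: differentiable_mxP => k l.
have -> : (fun y => (A y *m B y) k l) =
    \sum_j ((fun y => A y k j) * (fun y => B y j l)).
  by apply/funext => y; rewrite mxE fct_sumE.
by apply: differentiable_sum => j; apply: differentiableM;
  exact: differentiable_entry.
Qed.

Lemma derive_mulmx V a b c (A : V -> 'M[R]_(a, b))
    (B : V -> 'M[R]_(b, c)) x v :
  differentiable A x -> differentiable B x ->
  'D_v (fun y => A y *m B y) x = 'D_v A x *m B x + A x *m 'D_v B x.
Proof.
move=> dA dB; apply/matrixP => k l; rewrite derive_mxE; last first.
  exact: differentiable_mulmx.
have -> : (fun y => (A y *m B y) k l) =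
    \sum_j ((fun y => A y k j) * (fun y => B y j l)).
  by apply/funext => y; rewrite mxE fct_sumE.
have eA k' l' : derivable (fun y => A y k' l') x v.
  exact/diff_derivable/differentiable_entry.
have eB k' l' : derivable (fun y => B y k' l') x v.
  exact/diff_derivable/differentiable_entry.
rewrite derive_sum; last by move=> j; exact: derivableM.
rewrite !mxE -big_split; apply: eq_bigr => j _ /=.
rewrite deriveM// (derive_mxE _ _ _ dA) (derive_mxE _ _ _ dB) addrC.
by congr (_ + _); exact: mulrC.
Qed.

Lemma differentiable_trmx V a b (A : V -> 'M[R]_(a, b)) x :
  differentiable A x -> differentiable (fun y => (A y)^T) x.
Proof.
move=> dA; apply: differentiable_mxP => k l.
have -> : (fun y => (A y)^T k l) = (fun y => A y l k).
  by apply/funext => y; rewrite mxE.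
exact: differentiable_entry.
Qed.

Lemma derive_trmx V a b (A : V -> 'M[R]_(a, b)) x v : differentiable A x ->
  'D_v (fun y => (A y)^T) x = ('D_v A x)^T.
Proof.
move=> dA; apply/matrixP => k l.
rewrite derive_mxE; last exact: differentiable_trmx.
rewrite mxE derive_mxE//; congr ('D_v _ x).
by apply/funext => y; rewrite mxE.
Qed.

Lemma differentiable_scalemx V a b (s : V -> R) (A : V -> 'M[R]_(a, b)) x :
  differentiable s x -> differentiable A x ->
  differentiable (fun y => s y *: A y) x.
Proof.
move=> ds dA; apply: differentiable_mxP => k l.
have -> : (fun y => (s y *: A y) k l) = s * (fun y => A y k l).
  by apply/funext => y; rewrite mxE.
by apply: differentiableM => //; exact: differentiable_entry.
Qed.

Lemma derive_scalemx V a b (s : V -> R) (A : V -> 'M[R]_(a, b)) x v :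
  differentiable s x -> differentiable A x ->
  'D_v (fun y => s y *: A y) x = 'D_v s x *: A x + s x *: 'D_v A x.
Proof.
move=> ds dA; apply/matrixP => k l.
rewrite derive_mxE; last exact: differentiable_scalemx.
have -> : (fun y => (s y *: A y) k l) = s * (fun y => A y k l).
  by apply/funext => y; rewrite mxE.
rewrite deriveM; [|exact:
  diff_derivable|exact/diff_derivable/differentiable_entry].
rewrite !mxE (derive_mxE _ _ _ dA) addrC.
by congr (_ + _); exact: mulrC.
Qed.

Lemma derive_summx V a b (I : finType) (A : I -> V -> 'M[R]_(a, b)) x v :
  (forall i, differentiable (A i) x) ->
  'D_v (fun y => \sum_i A i y) x = \sum_i 'D_v (A i) x.
Proof.
move=> dA.
suff H (r : seq I) : differentiable (fun y => \sum_(i <- r) A i y) x /\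
    'D_v (fun y => \sum_(i <- r) A i y) x = \sum_(i <- r) 'D_v (A i) x.
  exact: (H (index_enum I)).2.
elim: r => [|i r [dIH IH]].
  have -> : (fun y => \sum_(i <- [::]) A i y) = cst 0.
    by apply/funext => y; rewrite big_nil.
  by rewrite big_nil derive_cst; split => //; exact: differentiable_cst.
have -> : (fun y => \sum_(i <- i :: r) A i y) =
   A i + (fun y => \sum_(i <- r) A i y).
  by apply/funext => y; rewrite big_cons.
split; first exact: differentiableD.
by rewrite big_cons deriveD ?IH//; exact: diff_derivable.
Qed.

Lemma smooth_differentiable V W (U : set V) (f : V -> W) x :
  smooth_on U f -> U x -> differentiable f x.
Proof. by move=> /(_ 0%N); exact: diff_on_differentiable. Qed.

Lemma smooth_derive V W (U : set V) (f : V -> W) v :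
  smooth_on U f -> smooth_on U ('D_v f).
Proof. by move=> Sf k; exact: (Sf k.+1).2. Qed.

Lemma smooth_eq V W (U : set V) (f g : V -> W) : open U ->
  (forall x, U x -> f x = g x) -> smooth_on U f -> smooth_on U g.
Proof. by move=> oU fg Sf k; exact: diff_on_eq fg (Sf k). Qed.

Lemma smooth_subset V W (U U' : set V) (f : V -> W) : U' `<=` U ->
  smooth_on U f -> smooth_on U' f.
Proof. by move=> UU' Sf k; exact: diff_on_subset (Sf k). Qed.

Lemma smooth_mxP V (U : set V) a b (A : V -> 'M[R]_(a, b)) : open U ->
  smooth_on U A <-> forall i j, smooth_on U (fun x => A x i j).
Proof.
move=> oU; split=> [SA i j k|SA k].
  by have [H _] := diff_on_mxP k A oU; exact: H.
by have [_ H] := diff_on_mxP k A oU; apply: H => i j; exact: SA.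
Qed.

Lemma smooth_cst V W (U : set V) (c : W) : smooth_on U (fun=> c).
Proof. by move=> k; exact: diff_on_cst. Qed.

Lemma smoothD V W (U : set V) (f g : V -> W) : open U ->
  smooth_on U f -> smooth_on U g -> smooth_on U (fun x => f x + g x).
Proof. by move=> oU Sf Sg k; exact: diff_onD. Qed.

Lemma smoothM V (U : set V) (f g : V -> R) : open U ->
  smooth_on U f -> smooth_on U g -> smooth_on U (fun x => f x * g x).
Proof. by move=> oU Sf Sg k; exact: diff_onM. Qed.

Lemma smoothN V (U : set V) (f : V -> R) : open U ->
  smooth_on U f -> smooth_on U (fun x => - f x).
Proof. by move=> oU Sf k; exact: diff_onN. Qed.

Lemma smooth_sum V (U : set V) (I : Type) (r : seq I) (f : I -> V -> R) :
  open U -> (forall i, smooth_on U (f i)) ->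
  smooth_on U (fun x => \sum_(i <- r) f i x).
Proof. by move=> oU Sf k; apply: diff_on_sum => // i; exact: Sf. Qed.

Lemma smooth_prod V (U : set V) (I : Type) (r : seq I) (f : I -> V -> R) :
  open U -> (forall i, smooth_on U (f i)) ->
  smooth_on U (fun x => \prod_(i <- r) f i x).
Proof. by move=> oU Sf k; apply: diff_on_prod => // i; exact: Sf. Qed.

Lemma smoothV V (U : set V) (f : V -> R) : open U ->
  (forall x, U x -> f x != 0) ->
  smooth_on U f -> smooth_on U (fun x => (f x)^-1).
Proof. by move=> oU f0 Sf k; exact: diff_onV. Qed.

Lemma smooth_comp V m a b (U : set V) (U' : set 'rV[R]_m)
    (f : 'rV[R]_m -> 'M[R]_(a, b)) (psi : V -> 'rV[R]_m) : open U -> open U' ->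
  (forall x, U x -> U' (psi x)) -> smooth_on U psi -> smooth_on U' f ->
  smooth_on U (f \o psi).
Proof.
move=> oU oU' UU' Sp /(smooth_mxP f oU') Sf; apply/(smooth_mxP _ oU) => i j k.
apply: (@diff_on_comp _ _ _ k _ U' (fun y => f y i j) psi oU UU').
  exact: Sp.
exact: Sf.
Qed.

Lemma smooth_mulmx V (U : set V) a b c (A : V -> 'M[R]_(a, b))
    (B : V -> 'M[R]_(b, c)) : open U ->
  smooth_on U A -> smooth_on U B -> smooth_on U (fun x => A x *m B x).
Proof.
move=> oU /(smooth_mxP _ oU) SA /(smooth_mxP _ oU) SB.
apply/(smooth_mxP _ oU) => i j.
apply: (smooth_eq oU (f := fun x => \sum_k A x i k * B x k j)).
  by move=> x _; rewrite mxE.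
by apply: smooth_sum => // k; exact: smoothM.
Qed.

Lemma smooth_trmx V (U : set V) a b (A : V -> 'M[R]_(a, b)) : open U ->
  smooth_on U A -> smooth_on U (fun x => (A x)^T).
Proof.
move=> oU /(smooth_mxP _ oU) SA; apply/(smooth_mxP _ oU) => i j.
by apply: (smooth_eq oU _ (SA j i)) => x _; rewrite mxE.
Qed.

Lemma smooth_scalemx V (U : set V) a b (s : V -> R) (A : V -> 'M[R]_(a, b)) :
  open U -> smooth_on U s -> smooth_on U A -> smooth_on U (fun x => s x *: A x).
Proof.
move=> oU Ss /(smooth_mxP _ oU) SA; apply/(smooth_mxP _ oU) => i j.
by apply: (smooth_eq oU _ (smoothM oU Ss (SA i j))) => x _; rewrite mxE.
Qed.

Lemma smooth_det V (U : set V) a (A : V -> 'M[R]_a) : open U ->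
  smooth_on U A -> smooth_on U (fun x => \det (A x)).
Proof.
move=> oU /(smooth_mxP _ oU) SA.
apply: smooth_sum => // s; apply: smoothM => //; first exact: smooth_cst.
by apply: smooth_prod.
Qed.

(** Cramer's rule reduces inversion to determinants. *)
Lemma smooth_invmx V (U : set V) a (A : V -> 'M[R]_a) : open U ->
  (forall x, U x -> A x \in unitmx) ->
  smooth_on U A -> smooth_on U (fun x => invmx (A x)).
Proof.
move=> oU uA SA.
apply: (smooth_eq oU (f := fun x => (\det (A x))^-1 *: \adj (A x))).
  by move=> x Ux; rewrite /invmx uA.
apply: smooth_scalemx => //.
  apply: smoothV => //; last exact: smooth_det.
  by move=> x /uA; rewrite unitmxE unitfE.
apply/(smooth_mxP _ oU) => i j.
apply: (smooth_eq oU (f := fun x => (-1) ^+ (j + i)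
  * \det (row' j (col' i (A x))))).
  by move=> x _; rewrite mxE.
apply: smoothM => //; first exact: smooth_cst.
apply: smooth_det => //; apply/(smooth_mxP _ oU) => k l.
have /(smooth_mxP _ oU) SA' := SA.
by apply: (smooth_eq oU _ (SA' (lift j k) (lift i l))) => x _; rewrite !mxE.
Qed.

(** The derivative of the constant function [invmx A *m A] vanishes. *)
Lemma derive_invmx V (U : set V) a (A : V -> 'M[R]_a) x v : open U ->
  (forall x, U x -> A x \in unitmx) -> smooth_on U A -> U x ->
  'D_v (fun y => invmx (A y)) x = - (invmx (A x) *m 'D_v A x *m invmx (A x)).
Proof.
move=> oU uA SA Ux.
have dA := smooth_differentiable SA Ux.
have dV := smooth_differentiable (smooth_invmx oU uA SA) Ux.
have : 'D_v (fun y => invmx (A y) *m A y) x = 0.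
  rewrite -(derive_cst (1%:M : 'M[R]_a) x v); apply: near_eq_derive.
  by apply: (open_eq_near oU Ux) => y Uy; rewrite mulVmx// uA.
rewrite derive_mulmx// => /(congr1 (mulmxr (invmx (A x)))) /=.
rewrite mul0mx mulmxDl mulmxK ?uA// => /eqP.
by rewrite addr_eq0 => /eqP.
Qed.

Lemma smooth_derive_commute V (U : set V) a b (A : V -> 'M[R]_(a, b)) x u v :
  open U -> U x -> smooth_on U A ->
  'D_u ('D_v A) x = 'D_v ('D_u A) x.
Proof.
move=> oU Ux SA; apply/matrixP => i j.
have E w w' : ('D_w ('D_w' A) x) i j =
    'D_w (fun y => 'D_w' (fun z => A z i j) y) x.
  transitivity ('D_w (fun y => 'D_w' A y i j) x).
    by apply: derive_mxE; exact: smooth_differentiable (smooth_derive w' SA) Ux.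
  apply: near_eq_derive; apply: (open_eq_near oU Ux) => y Uy.
  by apply: derive_mxE; exact: smooth_differentiable SA Uy.
have /(smooth_mxP _ oU)/(_ i j 1%N) Sij := SA.
apply: etrans (E u v) _; apply: etrans (esym (E v u)).
exact: (derive_commute u v oU Ux Sij).
Qed.

End MatrixCalculus.

Section Entries.
Variables (R : pzRingType) (a b : nat).
Implicit Types A B : 'M[R]_(a, b).
Lemma entryD A B k l : (A + B) k l = A k l + B k l. Proof. by rewrite mxE. Qed.
Lemma entryN A k l : (- A) k l = - A k l. Proof. by rewrite mxE. Qed.
Lemma entryZ c A k l : (c *: A) k l = c * A k l. Proof. by rewrite mxE. Qed.
Lemma entry0 k l : (0 : 'M[R]_(a, b)) k l = 0. Proof. by rewrite mxE. Qed.
Lemma trmxD A B : (A + B)^T = A^T + B^T. Proof. exact: linearD. Qed.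
Lemma trmxN A : (- A)^T = - A^T. Proof. exact: linearN. Qed.
Lemma trmxZ c A : (c *: A)^T = c *: A^T. Proof. exact: linearZ. Qed.
End Entries.

Definition entryE := (entryD, entryN, entryZ, entry0).

(** Matrix products are treated as atoms, so their sizes may differ. *)
Ltac mx_linear := apply/matrixP => ? ?; rewrite !entryE; ring.

(** * The Levi-Civita connection in coordinates *)

(** Sealed, so that comparing two distinct derivatives never unfolds the
limits behind them. *)
HB.lock Definition partial (R : realType) n a b (i : 'I_n)
  (A : 'rV[R]_n -> 'M[R]_(a, b)) (x : 'rV[R]_n) : 'M[R]_(a, b) :=
  'D_(delta_mx 0 i) A x.

(** Row [j] holds the components of [nabla_i d_j]. *)
HB.lock Definition conn (R : realType) n (G : 'rV[R]_n -> 'M[R]_n) (i : 'I_n)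
  (x : 'rV[R]_n) : 'M[R]_n := \matrix_(j, k) christoffel G k i j x.

(** Each row of [N] is a vector field; an [a]-tuple of fields is
differentiated at once, which lets matrix products express contractions. *)
HB.lock Definition covariant (R : realType) n (G : 'rV[R]_n -> 'M[R]_n) a
  (N : 'rV[R]_n -> 'M[R]_(a, n)) (i : 'I_n) (x : 'rV[R]_n) : 'M[R]_(a, n) :=
  partial i N x + N x *m conn G i x.

Section Coordinates.
Variables (R : realType) (n : nat).
Local Notation point := 'rV[R]_n.

Lemma partialE a b (i : 'I_n) (A : point -> 'M[R]_(a, b)) :
  partial i A = 'D_(delta_mx 0 i) A.
Proof. by apply/funext => x; rewrite partial.unlock. Qed.

Lemma connE (G : point -> 'M[R]_n) i x j k : conn G i x j k =
  christoffel G k i j x.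
Proof. by rewrite conn.unlock mxE. Qed.

(** Row [k] holds the components of [R (d_i, d_j) d_k]. *)
Definition curvature (G : point -> 'M[R]_n) (i j : 'I_n) (x : point) :
  'M[R]_n :=
  partial i (conn G j) x - partial j (conn G i) x
  + conn G j x *m conn G i x - conn G i x *m conn G j x.

Lemma covariantE (G : point -> 'M[R]_n) a (N : point -> 'M[R]_(a, n)) i :
  covariant G N i = fun x => partial i N x + N x *m conn G i x.
Proof. by apply/funext => x; rewrite covariant.unlock. Qed.

Variables (U : set point) (G : point -> 'M[R]_n).
Hypotheses (oU : open U) (SG : smooth_on U G).
Hypotheses (Gsym : forall x, (G x)^T = G x).
Hypothesis Gunit : forall x, U x -> G x \in unitmx.

Lemma partial_smooth a b i (A : point -> 'M[R]_(a, b)) :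
  smooth_on U A -> smooth_on U (partial i A).
Proof. by rewrite partialE; exact: smooth_derive. Qed.

Lemma partial_eq a b i (A B : point -> 'M[R]_(a, b)) x :
  U x -> (forall y, U y -> A y = B y) -> partial i A x = partial i B x.
Proof.
by move=> Ux AB; rewrite !partialE; apply: near_eq_derive;
  exact: open_eq_near AB.
Qed.

Lemma partial_entry a b i (A : point -> 'M[R]_(a, b)) x k l :
  smooth_on U A -> U x -> partial i A x k l = pd i (fun y => A y k l) x.
Proof. by move=> SA Ux; rewrite !partialE; apply: derive_mxE;
  exact: smooth_differentiable SA Ux. Qed.

Lemma partial_mul a b c i (A : point -> 'M[R]_(a, b)) (B : point ->
  'M[R]_(b, c)) x :
  smooth_on U A -> smooth_on U B -> U x ->
  partial i (fun y => A y *m B y) x = partial i A x *m B x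
    + A x *m partial i B x.
Proof.
by move=> SA SB Ux; rewrite !partialE; apply: derive_mulmx;
  [exact: smooth_differentiable SA Ux|exact: smooth_differentiable SB Ux].
Qed.

Lemma partial_add a b i (A B : point -> 'M[R]_(a, b)) x :
  smooth_on U A -> smooth_on U B -> U x ->
  partial i (fun y => A y + B y) x = partial i A x + partial i B x.
Proof.
by move=> SA SB Ux; rewrite !partialE; apply: deriveD; apply: diff_derivable;
  [exact: smooth_differentiable SA Ux|exact: smooth_differentiable SB Ux].
Qed.

Lemma partial_scale a b i (s : point -> R) (A : point -> 'M[R]_(a, b)) x :
  smooth_on U s -> smooth_on U A -> U x ->
  partial i (fun y => s y *: A y) x = pd i s x *: A x + s x *: partial i A x.
Proof.
by move=> SA SB Ux; rewrite !partialE; apply: derive_scalemx;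
  [exact: smooth_differentiable SA Ux|exact: smooth_differentiable SB Ux].
Qed.

Lemma partial_trmx a b i (A : point -> 'M[R]_(a, b)) x : smooth_on U A -> U x ->
  partial i (fun y => (A y)^T) x = (partial i A x)^T.
Proof.
by move=> SA Ux; rewrite !partialE; apply: derive_trmx;
  exact: smooth_differentiable SA Ux.
Qed.

Lemma partial_inv i x : U x ->
  partial i (fun y => invmx (G y)) x = - (invmx (G x) *m partial i G x
    *m invmx (G x)).
Proof. by move=> Ux; rewrite !partialE; exact: (derive_invmx _ oU Gunit SG Ux).
Qed.

Lemma partial_commute a b i j (A : point -> 'M[R]_(a, b)) x : smooth_on U A ->
  U x ->
  partial i (partial j A) x = partial j (partial i A) x.
Proof. by move=> SA Ux; rewrite !partialE;
  exact: (smooth_derive_commute _ _ oU Ux SA). Qed.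

Lemma smooth_entry a b (A : point -> 'M[R]_(a, b)) i j :
  smooth_on U A -> smooth_on U (fun x => A x i j).
Proof. by move=> /(smooth_mxP _ oU). Qed.

Lemma inverse_smooth : smooth_on U (fun x => invmx (G x)).
Proof. exact: smooth_invmx. Qed.

Lemma conn_smooth i : smooth_on U (conn G i).
Proof.
apply/(smooth_mxP _ oU) => j k.
have Sd i' j' k' : smooth_on U (pd i' (fun y => G y j' k')).
  by apply: smooth_derive; exact: smooth_entry.
apply: (smooth_eq oU (f := fun x => christoffel G k i j x)).
  by move=> x _; rewrite connE.
apply: smoothM => //; first exact: smooth_cst.
apply: smooth_sum => // l; apply: smoothM => //.
  by apply: smooth_entry; exact: inverse_smooth.
by apply: smoothD => //; [exact: smoothD|exact: smoothN].
Qed.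

Lemma sym_entry x i j : G x i j = G x j i.
Proof. by rewrite -{1}Gsym mxE. Qed.

Lemma pd_sym x i j k : pd i (fun y => G y j k) x = pd i (fun y => G y k j) x.
Proof. by congr (pd i _ x); apply/funext => y; exact: sym_entry. Qed.

Lemma conn_torsion i j k x : conn G i x j k = conn G j x i k.
Proof.
rewrite !connE /christoffel; congr (_ * _); apply: eq_bigr => l _.
by rewrite (pd_sym _ l) [X in X - _]addrC.
Qed.

Lemma inverse_sym x : (invmx (G x))^T = invmx (G x).
Proof. by rewrite trmx_inv Gsym. Qed.

Lemma conn_lower i x j l : U x -> (conn G i x *m G x) j l =
  2^-1 * (pd i (fun y => G y j l) x + pd j (fun y => G y i l) x
          - pd l (fun y => G y i j) x).
Proof.
move=> Ux; pose M := \matrix_(j, l) (2^-1 * (pd i (fun y => G y j l) x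
  + pd j (fun y => G y i l) x - pd l (fun y => G y i j) x)).
suff -> : conn G i x = M *m invmx (G x) by rewrite mulmxKV ?Gunit// mxE.
rewrite -[RHS]trmxK trmx_mul inverse_sym.
apply/matrixP => j' k; rewrite connE !mxE /christoffel mulr_sumr.
by apply: eq_bigr => l' _; rewrite !mxE; ring.
Qed.

(** The metric is parallel: in the sum of the symbols of the first kind for
[(j, l)] and for [(l, j)] all but the derivative in the direction [i] cancels.
*)
Lemma conn_compat i x : U x ->
  partial i G x = conn G i x *m G x + G x *m (conn G i x)^T.
Proof.
move=> Ux; apply/matrixP => j l; rewrite entryD (partial_entry _ _ _ SG Ux).
have -> : (G x *m (conn G i x)^T) j l = (conn G i x *m G x) l j.
  by rewrite -[in LHS](Gsym x) -trmx_mul mxE.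
by rewrite !conn_lower// (pd_sym x i l j) (pd_sym x i j l); field.
Qed.

Lemma partial_inv_christoffel i x : U x -> partial i (fun y => invmx (G y)) x =
  - (invmx (G x) *m conn G i x) - (conn G i x)^T *m invmx (G x).
Proof.
move=> Ux; rewrite partial_inv// conn_compat// mulmxDr mulmxDl.
by rewrite mulmxA mulmxK ?Gunit// mulmxA mulVmx ?Gunit// mul1mx opprD.
Qed.

Lemma riemann_curvature i j k l x : U x -> riemann G l k i j x =
  curvature G i j x k l.
Proof.
move=> Ux; rewrite /curvature !entryE.
rewrite (partial_entry i k l (conn_smooth j) Ux) (partial_entry j k l
  (conn_smooth i) Ux).
have E i' j' k' : pd i' (fun y => conn G j' y k' l) x =
  pd i' (christoffel G l j' k') x.
  by congr (pd i' _ x); apply/funext => y; rewrite connE.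
rewrite (E i j k) (E j i k) /riemann -!addrA; congr (_ + (_ + _)).
rewrite !mxE -sumrB; apply: eq_bigr => m _.
rewrite !connE; congr (_ - _); exact: mulrC.
Qed.

Lemma covariant_smooth a (N : point -> 'M[R]_(a, n)) i :
  smooth_on U N -> smooth_on U (covariant G N i).
Proof.
move=> SN; rewrite covariantE; apply: smoothD => //;
  first exact: partial_smooth.
by apply: smooth_mulmx => //; exact: conn_smooth.
Qed.

(** The terms in the first derivatives of [N] are symmetric in [i] and [j],
and so are its second derivatives. *)
Lemma ricci_identity a (N : point -> 'M[R]_(a, n)) i j x :
  smooth_on U N -> U x ->
  covariant G (covariant G N j) i x - covariant G (covariant G N i) j x =
    N x *m curvature G i j x.
Proof.
move=> SN Ux.
have E i' j' : covariant G (covariant G N j') i' x =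
    partial i' (partial j' N) x + partial i' N x *m conn G j' x
      + N x *m partial i' (conn G j') x
    + partial j' N x *m conn G i' x + N x *m conn G j' x *m conn G i' x.
  rewrite !covariantE partial_add//; [|exact: partial_smooth|]; last first.
    by apply: smooth_mulmx => //; exact: conn_smooth.
  by rewrite partial_mul//; [rewrite mulmxDl !addrA|exact: conn_smooth].
rewrite !E (partial_commute i j SN Ux) /curvature !mulmxDr !mulmxN !mulmxA.
mx_linear.
Qed.

Lemma covariant_mul a b (C : point -> 'M[R]_(a, b)) (N : point ->
  'M[R]_(b, n)) i x :
  smooth_on U C -> smooth_on U N -> U x ->
  covariant G (fun y => C y *m N y) i x = partial i C x *m N x
    + C x *m covariant G N i x.
Proof.
by move=> SC SN Ux; rewrite !covariantE partial_mul// mulmxDr !mulmxA addrA.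
Qed.

Lemma covariant_add a (M N : point -> 'M[R]_(a, n)) i x :
  smooth_on U M -> smooth_on U N -> U x ->
  covariant G (fun y => M y + N y) i x = covariant G M i x + covariant G N i x.
Proof.
by move=> SM SN Ux; rewrite !covariantE partial_add// mulmxDl addrACA.
Qed.

Lemma covariant_scale a (s : point -> R) (N : point -> 'M[R]_(a, n)) i x :
  smooth_on U s -> smooth_on U N -> U x ->
  covariant G (fun y => s y *: N y) i x = pd i s x *: N x + s x *:
    covariant G N i x.
Proof.
by move=> Ss SN Ux; rewrite !covariantE partial_scale// scalerDr
  -scalemxAl addrA.
Qed.

Lemma covariant_eq a (M N : point -> 'M[R]_(a, n)) i x : U x ->
  (forall y, U y -> M y = N y) -> covariant G M i x = covariant G N i x.
Proof. by move=> Ux MN; rewrite !covariantE (partial_eq i Ux MN) MN. Qed.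

(** The inverse metric is parallel as a tensor with two upper indices; only
one of them is differentiated covariantly here, so the correction for the
other one remains. *)
Lemma covariant_inv i x : U x ->
  covariant G (fun y => invmx (G y)) i x = - ((conn G i x)^T *m invmx (G x)).
Proof. by move=> Ux; rewrite !covariantE partial_inv_christoffel//; mx_linear.
Qed.

(** The Ricci identity for the rows of the inverse metric: by [covariant_inv]
their covariant derivatives are again the inverse metric, multiplied on the
left by connection matrices, so that the second ones assemble to the
transposed curvature applied to the inverse metric, up to sign. *)
Lemma curvature_skew i j x : U x ->
  (curvature G i j x)^T *m invmx (G x) = - (invmx (G x) *m curvature G i j x).
Proof.
move=> Ux; have SP := inverse_smooth.
have SC k : smooth_on U (fun y => (conn G k y)^T).
  by apply: smooth_trmx => //; exact: conn_smooth.
rewrite -(ricci_identity i j SP Ux).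
have E k l : covariant G (covariant G (fun y => invmx (G y)) l) k x =
    (conn G l x)^T *m (conn G k x)^T *m invmx (G x)
    - (partial k (conn G l) x)^T *m invmx (G x).
  rewrite (covariant_eq (N := fun y => -1 *: ((conn G l y)^T *m invmx (G y))) _
    Ux).
    rewrite covariant_scale//; [|exact: smooth_cst|exact: smooth_mulmx].
    rewrite covariant_mul// covariant_inv// (partial_trmx k (conn_smooth l) Ux)
      mulmxN mulmxA.
    rewrite /pd derive_cst; mx_linear.
  by move=> y Uy; rewrite covariant_inv// scaleN1r.
rewrite (E i j) (E j i) /curvature !(trmxD, trmxN) !trmx_mul !(mulmxDl, mulNmx).
mx_linear.
Qed.

End Coordinates.

Definition ricci_mx (R : realType) n (G : 'rV[R]_n -> 'M[R]_n) (x : 'rV[R]_n) :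
  'M[R]_n := \matrix_(j, k) \sum_i curvature G i j x k i.

Lemma mul_ricci_mx (R : realType) a n (G : 'rV[R]_n ->
  'M[R]_n) (N : 'M[R]_(a, n)) x k j :
  (N *m (ricci_mx G x)^T) k j = \sum_i (N *m curvature G i j x) k i.
Proof.
rewrite mxE; under [RHS]eq_bigr do rewrite mxE.
rewrite exchange_big; apply: eq_bigr => l _ /=.
by rewrite !mxE mulr_sumr.
Qed.

(** * Vanishing of a symmetric form with values in the base *)

Section SecondFundamentalForm.
Variables (R : realFieldType) (n m : nat).
Variables (D : 'I_n -> 'M[R]_(n, m)) (E T : 'M[R]_(n, m)).
Definition along (u : 'rV[R]_n) : 'M[R]_(n, m) := \sum_i u 0 i *: D i.
Hypothesis D_sym : forall i j a, D i j a = D j i a.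
Hypothesis D_skew : forall i, (D i)^T *m E + E^T *m D i = 0.
Hypothesis ET_unit : E^T *m T \in unitmx.
Hypothesis D_vertical : forall u v : 'rV[R]_n, u *m T = 0 -> v *m T = 0 ->
  v *m along u = 0.
Hypothesis D_mixed : forall u : 'rV[R]_n, u *m T = 0 ->
  (E^T *m along u)^T = E^T *m along u.

Lemma along_sym u v : v *m along u = u *m along v.
Proof.
have F w z a : (w *m along z) 0 a = \sum_j \sum_i w 0 j * z 0 i * D i j a.
  rewrite mxE; apply: eq_bigr => j _; rewrite /along. rewrite summxE mulr_sumr.
  by apply: eq_bigr => i _; rewrite entryZ mulrA.
apply/rowP => a; rewrite !F exchange_big; apply: eq_bigr => j _.
by apply: eq_bigr => i _; rewrite D_sym (mulrC (v 0 i)).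
Qed.

Lemma along_skew u : (E^T *m along u)^T = - (E^T *m along u).
Proof.
apply/eqP; rewrite -addr_eq0 /along mulmx_sumr raddf_sum -big_split big1//= =>
  i _.
by rewrite trmx_mul trmxK trmxZ -scalemxAl -scalemxAr -scalerDr D_skew scaler0.
Qed.

Lemma skew_sym_eq0 (S : 'M[R]_m) : S^T = S -> S^T = - S -> S = 0.
Proof.
move=> S1 S2; apply/matrixP => i j.
have := congr1 (fun M : 'M[R]_m => M i j) S2.
by rewrite /= {1}S1 !mxE; lra.
Qed.

(** As [E^T *m T] is invertible, every row vector is the sum of one killed by
[T] and of a combination of the rows of [E^T]. *)
Lemma along_eq0 u : (forall v : 'rV[R]_n, v *m T = 0 -> v *m along u = 0) ->
  E^T *m along u = 0 -> along u = 0.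
Proof.
move=> Hv Hh; apply/row_matrixP => i; rewrite rowE row0.
pose w := delta_mx 0 i *m T *m invmx (E^T *m T) *m E^T : 'rV[R]_n.
rewrite -[delta_mx 0 i](subrK w) mulmxDl Hv ?add0r.
  by rewrite /w -mulmxA Hh mulmx0.
by rewrite mulmxBl /w -(mulmxA _ E^T) mulmxKV// subrr.
Qed.

(** View [v *m along u] as a symmetric bilinear form with values in the base,
where the left kernel of [T] is vertical and the rows of [E^T] span the
horizontal space. For vertical [u] the matrix [E^T *m along u] is skew and
symmetric, so the form vanishes on mixed pairs. On horizontal vectors it is
the difference of two torsion-free metric connections, which is zero. *)
Lemma second_form_eq0 i : D i = 0.
Proof.
have D0 u : u *m T = 0 -> along u = 0.
  move=> uT; apply: along_eq0 => [v vT|]; first exact: D_vertical.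
  by apply: skew_sym_eq0; [exact: D_mixed|exact: along_skew].
have D1 u : E^T *m along u = 0 -> along u = 0.
  by move=> H; apply: along_eq0 => // v /D0 vT; rewrite along_sym vT mulmx0.
have hor b : along (row b E^T) = 0.
  apply: D1; apply/matrixP => c a; rewrite entry0.
  pose k a b c := (E^T *m along (row b E^T)) c a.
  have k_sym a' b' c' : k a' b' c' = k a' c' b'.
    have := along_sym (row b' E^T) (row c' E^T).
    have rowE (M : 'M[R]_m) i' j' : row i' M 0 j' = M i' j' by rewrite mxE.
    by rewrite -!row_mul => /rowP/(_ a'); rewrite !rowE.
  have k_skew a' b' c' : k a' b' c' = - k c' b' a'.
    have := along_skew (row b' E^T) => /matrixP/(_ a' c').
    by rewrite entryN (mxE _ _ a' c').
  (* A trilinear form that is symmetric in its last two arguments and skew in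
     its outer ones vanishes. *)
  have : k a b c = - k a b c.
    rewrite {1}k_skew {1}k_sym {1}k_skew opprK {1}k_sym {1}k_skew.
    by rewrite {1}k_sym.
  by rewrite -/(k a b c); lra.
suff : along (delta_mx 0 i) = 0.
  rewrite /along (bigD1 i)//= big1 ?addr0 => [|j ji].
    by rewrite mxE !eqxx scale1r.
  by rewrite mxE (negPf ji) andbF scale0r.
apply: D1; apply/row_matrixP => b; rewrite row_mul row0 along_sym.
by rewrite hor mulmx0.
Qed.

End SecondFundamentalForm.

(** * Conformal submersions in coordinates *)

(** Conformality is stated on the cotangent side: the gradients of the
components of [theta], which span the horizontal space, have Gram matrix
[s ^ 2] times the inverse metric of the base. This form contains the
surjectivity of the differential, and the last clause says that the gradient
of [s] is vertical. *)
Record local_conformal (R : realType) n m (U : set 'rV[R]_n) (V : set 'rV[R]_m)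
    (G : 'rV[R]_n -> 'M[R]_n) (H : 'rV[R]_m -> 'M[R]_m)
    (theta : 'rV[R]_n -> 'rV[R]_m) (s : 'rV[R]_n -> R) : Prop :=
      LocalConformal {
  lc_openU : open U ;
  lc_openV : open V ;
  lc_maps : forall x, U x -> V (theta x) ;
  lc_theta : smooth_on U theta ;
  lc_s : smooth_on U s ;
  lc_s_neq0 : forall x, U x -> s x != 0 ;
  lc_G : smooth_on U G ;
  lc_Gsym : forall x, (G x)^T = G x ;
  lc_Gunit : forall x, U x -> G x \in unitmx ;
  lc_H : smooth_on V H ;
  lc_Hsym : forall y, (H y)^T = H y ;
  lc_Hunit : forall y, V y -> H y \in unitmx ;
  lc_cometric : forall x, U x ->
    ('J theta x)^T *m invmx (G x) *m 'J theta x = s x ^+ 2 *: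
      invmx (H (theta x)) ;
  lc_homothetic : forall x, U x ->
    (\row_i pd i s x) *m invmx (G x) *m 'J theta x = 0
}.

(** Entry [(j, a)] is the covariant Hessian [nabla_i nabla_j theta^a]. *)
HB.lock Definition hess (R : realType) n m (G : 'rV[R]_n -> 'M[R]_n)
    (theta : 'rV[R]_n -> 'rV[R]_m) (i : 'I_n) (x : 'rV[R]_n) : 'M[R]_(n, m) :=
  partial i (fun y => 'J theta y) x - conn G i x *m 'J theta x.

(** Row [a] is the gradient of the component [a] of [theta]. *)
HB.lock Definition hlift (R : realType) n m (G : 'rV[R]_n -> 'M[R]_n)
    (theta : 'rV[R]_n -> 'rV[R]_m) (x : 'rV[R]_n) : 'M[R]_(m, n) :=
  ('J theta x)^T *m invmx (G x).

Section Jacobian.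
Variables (R : realType) (n : nat).

Lemma jacobianE m (f : 'rV[R]_n -> 'rV[R]_m) x i a : differentiable f x ->
  ('J f x) i a = ('D_(delta_mx 0 i) f x) 0 a.
Proof. by move=> df; rewrite derivemxE// -rowE [RHS]mxE. Qed.

Lemma row_jacobian m (f : 'rV[R]_n -> 'rV[R]_m) x i : differentiable f x ->
  row i ('J f x) = partial i f x.
Proof. by move=> df; rewrite partialE derivemxE// -rowE. Qed.

Lemma jacobian_smooth m (U : set 'rV[R]_n) (f : 'rV[R]_n -> 'rV[R]_m) :
  open U -> smooth_on U f -> smooth_on U (fun x => 'J f x).
Proof.
move=> oU Sf; apply/(smooth_mxP _ oU) => i a.
apply: (smooth_eq oU (f := fun x => ('D_(delta_mx 0 i) f x) 0 a)).
  by move=> x Ux; rewrite jacobianE//; exact: smooth_differentiable Sf Ux.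
have /(smooth_mxP _ oU) := smooth_derive (delta_mx 0 i) Sf; exact.
Qed.

Lemma partial_jacobian_sym m (U : set 'rV[R]_n) (f : 'rV[R]_n ->
  'rV[R]_m) i j a x :
  open U -> smooth_on U f -> U x ->
  partial i (fun y => 'J f y) x j a = partial i (partial j f) x 0 a.
Proof.
move=> oU Sf Ux.
rewrite (partial_entry i j a (jacobian_smooth oU Sf) Ux) (partial_entry i 0 a
  (partial_smooth j Sf) Ux).
apply: near_eq_derive; apply: (open_eq_near oU Ux) => y Uy.
by rewrite jacobianE ?partialE//; exact: smooth_differentiable Sf Uy.
Qed.

Lemma partial_comp m a b (U : set 'rV[R]_n) (V : set 'rV[R]_m)
    (f : 'rV[R]_m -> 'M[R]_(a, b)) (psi : 'rV[R]_n -> 'rV[R]_m) i x :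
  smooth_on U psi -> smooth_on V f -> U x -> V (psi x) ->
  partial i (fun y => f (psi y)) x = \sum_c ('J psi x) i c *:
    partial c f (psi x).
Proof.
move=> Sp Sf Ux Vx; have dpsi := smooth_differentiable Sp Ux.
rewrite partialE -[fun y => _]/(f \o psi) derive_comp_rV//; last first.
  exact: smooth_differentiable Sf Vx.
by apply: eq_bigr => c _; rewrite jacobianE// partialE.
Qed.

Lemma gradient_comp k (W : set 'rV[R]_n) (W' : set 'rV[R]_k)
    (f : 'rV[R]_k -> R) (phi : 'rV[R]_n -> 'rV[R]_k) x :
  smooth_on W phi -> smooth_on W' f -> W x -> W' (phi x) ->
  \row_i pd i (f \o phi) x = (\row_b pd b f (phi x)) *m ('J phi x)^T.
Proof.
move=> Sp Sf Wx Wx'; have dphi := smooth_differentiable Sp Wx.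
apply/rowP => i; rewrite mxE /pd derive_comp_rV//; last first.
  exact: smooth_differentiable Sf Wx'.
rewrite mxE; apply: eq_bigr => b _.
by rewrite mxE [_^T _ _]mxE jacobianE// mulrC.
Qed.

End Jacobian.

Section LogGradient.
Variables (R : realType) (n : nat) (U : set 'rV[R]_n).
Variables (G : 'rV[R]_n -> 'M[R]_n) (s : 'rV[R]_n -> R).

(** The differential of [ln s], written without the logarithm. *)
Definition log_diff (x : 'rV[R]_n) : 'rV[R]_n := \row_i ((s x)^-1 * pd i s x).

Definition log_grad (x : 'rV[R]_n) : 'rV[R]_n := log_diff x *m invmx (G x).

(** The divergence of the gradient of [ln s]. *)
Definition log_laplacian (x : 'rV[R]_n) : R :=
  \sum_i covariant G log_grad i x 0 i.

Hypotheses (oU : open U) (Ss : smooth_on U s) (SG : smooth_on U G).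
Hypothesis s0 : forall x, U x -> s x != 0.
Hypothesis Gunit : forall x, U x -> G x \in unitmx.

Lemma log_diff_smooth : smooth_on U log_diff.
Proof.
apply/(smooth_mxP _ oU) => i j.
apply: (smooth_eq oU (f := fun x => (s x)^-1 * pd j s x)).
  by move=> x _; rewrite mxE.
by apply: smoothM => //; [exact: smoothV|exact: smooth_derive].
Qed.

Lemma log_grad_smooth : smooth_on U log_grad.
Proof.
by apply: smooth_mulmx => //; [exact: log_diff_smooth|exact: inverse_smooth].
Qed.

Lemma log_diff_closed i j x : U x ->
  pd i (fun y => log_diff y 0 j) x = pd j (fun y => log_diff y 0 i) x.
Proof.
move=> Ux.
have ds y : U y -> differentiable s y by exact: smooth_differentiable.
have E i' j' : pd i' (fun y => log_diff y 0 j') x =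
    - (s x ^- 2 * pd i' s x) * pd j' s x + (s x)^-1 * pd i' (pd j' s) x.
  have -> : (fun y => log_diff y 0 j') = (fun y => (s y)^-1) * pd j' s.
    by apply/funext => y; rewrite mxE.
  have dsx := ds _ Ux.
  rewrite /pd deriveM; last 2 first.
  - by apply: diff_derivable; apply: differentiableV => //; exact: s0.
  - apply: diff_derivable.
    exact: smooth_differentiable (smooth_derive (delta_mx 0 j') Ss) Ux.
  rewrite deriveV; [|exact: s0|exact: diff_derivable].
  by rewrite addrC -[X in X + _ = _]/(_ * _) mulrC scaleNr.
have aux (a b c d k l : R) : c = d -> - (k * a) * b + l * c = - (k * b) * a
  + l * d.
  by move=> ->; ring.
have e : pd i (pd j s) x = pd j (pd i s) x.
  exact: (derive_commute _ _ oU Ux (Ss 1%N)).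
exact: etrans (E i j) (etrans (aux _ _ _ _ _ _ e) (esym (E j i))).
Qed.

Lemma log_laplacian_smooth : smooth_on U log_laplacian.
Proof.
apply: smooth_sum => // i; apply: (smooth_entry oU (A :=
  covariant G log_grad i)).
by apply: covariant_smooth => //; exact: log_grad_smooth.
Qed.

End LogGradient.

Section ConformalSubmersion.
Variables (R : realType) (n m : nat) (U : set 'rV[R]_n) (V : set 'rV[R]_m).
Variables (G : 'rV[R]_n -> 'M[R]_n) (H : 'rV[R]_m -> 'M[R]_m).
Variables (theta : 'rV[R]_n -> 'rV[R]_m) (s : 'rV[R]_n -> R).
Hypothesis C : local_conformal U V G H theta s.

Local Notation T x := ('J theta x).
Local Notation P x := (invmx (G x)).
Local Notation Q x := (invmx (H (theta x))).
Local Notation dlog := (log_diff s).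
Local Notation glog := (log_grad G s).
Local Notation lift := (hlift G theta).
(** The connection of the base pulled back along [theta]. *)
Definition pullback_conn (i : 'I_n) (x : 'rV[R]_n) : 'M[R]_m :=
  \sum_b T x i b *: conn H b (theta x).

Let oU := lc_openU C. Let oV := lc_openV C. Let UV := lc_maps C.
Let Sth := lc_theta C. Let Ss := lc_s C. Let s0 := lc_s_neq0 C.
Let SG := lc_G C. Let Gsym := lc_Gsym C. Let Gunit := lc_Gunit C.
Let SH := lc_H C. Let Hsym := lc_Hsym C. Let Hunit := lc_Hunit C.

Let ST : smooth_on U (fun x => T x). Proof. exact: jacobian_smooth. Qed.
Let SP : smooth_on U (fun x => P x). Proof. exact: inverse_smooth. Qed.
Let SQ : smooth_on V (fun y => invmx (H y)). Proof. exact: inverse_smooth. Qed.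

Lemma liftE : lift = fun x => (T x)^T *m P x.
Proof. by apply/funext => x; rewrite hlift.unlock. Qed.

Lemma lift_smooth : smooth_on U lift.
Proof. rewrite liftE; by apply: smooth_mulmx => //; exact: smooth_trmx. Qed.

Let dlog_smooth : smooth_on U dlog. Proof. exact: log_diff_smooth. Qed.
Let glog_smooth : smooth_on U glog. Proof. exact: log_grad_smooth. Qed.

Lemma lift_jacobian x : U x -> lift x *m T x = s x ^+ 2 *: Q x.
Proof. by rewrite liftE; exact: (lc_cometric C). Qed.

Lemma glog_jacobian x : U x -> glog x *m T x = 0.
Proof.
move=> Ux; rewrite /log_grad (_ : dlog x = (s x)^-1 *: \row_i pd i s x).
  by rewrite -!scalemxAl (lc_homothetic C Ux) scaler0.
by apply/rowP => i; rewrite !mxE.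
Qed.

Lemma hess_sym i j a x : U x -> hess G theta i x j a = hess G theta j x i a.
Proof.
move=> Ux; rewrite hess.unlock !entryD !entryN.
rewrite (partial_jacobian_sym i j a oU Sth Ux) (partial_jacobian_sym j i a oU
  Sth Ux).
rewrite (partial_commute oU i j Sth Ux); congr (_ - _); rewrite !mxE.
by apply: eq_bigr => k _; rewrite (conn_torsion Gsym).
Qed.

Lemma partial_jacobian i x :
  partial i (fun y => 'J theta y) x = hess G theta i x + conn G i x *m T x.
Proof. by rewrite hess.unlock subrK. Qed.

Lemma covariant_lift i x : U x -> covariant G lift i x = (hess G theta i x)^T
  *m P x.
Proof.
move=> Ux; rewrite liftE (covariant_mul (U := U))//; last exact: smooth_trmx.
rewrite (covariant_inv oU SG Gsym Gunit)// (partial_trmx i ST Ux)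
  partial_jacobian trmxD trmx_mul mulmxDl mulmxN.
by rewrite !mulmxA addrK.
Qed.

(** The covariant derivative of [lc_cometric]; the derivative of the inverse
metric of the base enters through its Christoffel symbols. *)
Lemma hess_lift i x : U x ->
  (hess G theta i x)^T *m (P x *m T x) + lift x *m hess G theta i x =
  (2 * s x ^+ 2 * dlog x 0 i) *: Q x
  - s x ^+ 2 *: (\sum_b T x i b *: ((conn H b (theta x))^T *m Q x
                   + Q x *m conn H b (theta x))).
Proof.
move=> Ux; have Vx := UV Ux.
have Ss2 : smooth_on U (fun y => s y ^+ 2).
  by apply: (smooth_eq oU _ (smoothM oU Ss Ss)) => y _; rewrite expr2.
have SQt : smooth_on U (fun y => Q y).
  exact: (smooth_comp oU oV UV Sth SQ).
have e1 : partial i (fun y => lift y *m T y) x =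
    (hess G theta i x)^T *m (P x *m T x) + lift x *m hess G theta i x.
  rewrite (partial_mul i lift_smooth ST Ux) partial_jacobian.
  have -> : partial i lift x = covariant G lift i x
    - lift x *m conn G i x by rewrite covariantE addrK.
  by rewrite covariant_lift// mulmxBl mulmxDr !mulmxA; mx_linear.
rewrite -e1 (partial_eq oU i Ux (B := fun y => s y ^+ 2 *: Q y)); last first.
  by move=> y Uy; rewrite lift_jacobian.
rewrite (partial_scale i Ss2 SQt Ux) (partial_comp i Sth SQ Ux Vx).
have -> : pd i (fun y => s y ^+ 2) x = 2 * s x ^+ 2 * dlog x 0 i.
  have ds := diff_derivable (smooth_differentiable Ss Ux).
  rewrite /pd -[fun y => _]/(s ^+ 2) deriveX//= mxE /pd.
  rewrite -[LHS]/(_ * _); field; exact: s0.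
congr (_ + _); rewrite -scalerN -sumrN; congr (_ *: _); apply: eq_bigr => b _.
by rewrite (partial_inv_christoffel oV SH Hsym Hunit) // -scalerN opprD addrC.
Qed.

(** The Hessian of the projection of a warped product onto its horizontal
factor. *)
Definition model_hess (i : 'I_n) (x : 'rV[R]_n) : 'M[R]_(n, m) :=
  dlog x 0 i *: T x + (dlog x)^T *m row i (T x) - T x *m pullback_conn i x.

Lemma pullback_conn_torsion i j x :
  row i (T x) *m pullback_conn j x = row j (T x) *m pullback_conn i x.
Proof.
apply/rowP => a; rewrite /pullback_conn !mulmx_sumr !summxE.
have E k l b : (row k (T x) *m (T x l b *: conn H b (theta x))) 0 a =
    \sum_c T x k c * T x l b * conn H b (theta x) c a.
  by rewrite mxE; apply: eq_bigr => c _; rewrite !mxE; ring.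
under eq_bigr do rewrite E; under [RHS]eq_bigr do rewrite E.
rewrite exchange_big; apply: eq_bigr => b _; apply: eq_bigr => c _.
by rewrite (conn_torsion Hsym) (mulrC (T x i b)).
Qed.

Lemma along_pullback_conn (u : 'rV[R]_n) x : u *m T x = 0 ->
  \sum_i u 0 i *: pullback_conn i x = 0.
Proof.
move=> uT; rewrite /pullback_conn.
under eq_bigr do rewrite scaler_sumr.
rewrite exchange_big big1//= => b _.
under eq_bigr do rewrite scalerA.
rewrite -scaler_suml (_ : \sum_i _ = (u *m T x) 0 b); last by rewrite mxE.
by rewrite uT entry0 scale0r.
Qed.

Lemma along_model_hess (u : 'rV[R]_n) x : u *m T x = 0 ->
  along (fun i => model_hess i x) u = (\sum_i u 0 i * dlog x 0 i) *: T x.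
Proof.
move=> uT; rewrite /along /model_hess.
have uT' : \sum_i u 0 i *: row i (T x) = 0.
  rewrite -[RHS]uT; apply/rowP => a; rewrite summxE [RHS]mxE.
  by apply: eq_bigr => i _; rewrite !mxE.
under eq_bigr do rewrite scalerBr scalerDr scalerA !scalemxAr.
rewrite sumrB big_split /= -scaler_suml -!mulmx_sumr along_pullback_conn// uT'.
by rewrite !mulmx0 subr0 addr0.
Qed.

(** The difference of the two Hessians satisfies the hypotheses of
[second_form_eq0]: it is skew against horizontal vectors because both Hessians
satisfy [hess_lift], and [model_hess] vanishes on pairs of vertical vectors
and is symmetric on mixed pairs. *)
Lemma hess_eq_model x : U x ->
  (forall u v : 'rV[R]_n, u *m T x = 0 -> v *m T x = 0 ->
     v *m along (fun i => hess G theta i x) u = 0) ->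
  (forall u : 'rV[R]_n, u *m T x = 0 ->
     (lift x *m along (fun i => hess G theta i x) u)^T =
     lift x *m along (fun i => hess G theta i x) u) ->
  forall i, hess G theta i x = model_hess i x.
Proof.
move=> Ux HV HM i; apply/eqP; rewrite -subr_eq0; apply/eqP.
have Et : (P x *m T x)^T = lift x by rewrite liftE trmx_mul (inverse_sym Gsym).
have gT : (lift x *m (dlog x)^T)^T = 0.
  by rewrite trmx_mul trmxK -Et trmxK mulmxA glog_jacobian.
have gT' : lift x *m (dlog x)^T = 0 by rewrite -[LHS]trmxK gT trmx0.
have QsymT : (Q x)^T = Q x by rewrite (inverse_sym Hsym).
have alongB u : along (fun i => hess G theta i x - model_hess i x) u =
    along (fun i => hess G theta i x) u - along (fun i => model_hess i x) u.
  by rewrite /along -sumrB; apply: eq_bigr => k _; rewrite scalerBr.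
apply: (@second_form_eq0 _ _ _ (fun i => hess G theta i x - model_hess i x)
  (P x *m T x) (T x)).
- move=> j k a /=; rewrite [LHS]entryD [RHS]entryD 2!entryN hess_sym//;
  congr (_ - _).
  rewrite /model_hess !entryD !entryN.
  have -> : (T x *m pullback_conn j x) k a = (T x *m pullback_conn k x) j a.
    have /rowP/(_ a) := pullback_conn_torsion k j x.
    by rewrite -!row_mul (mxE _ _ 0 a) (mxE _ _ 0 a).
  have outer (u : 'rV[R]_n) (v : 'rV[R]_m) k' a' : (u^T *m v) k' a' =
    u 0 k' * v 0 a'.
    by rewrite mxE big_ord1 mxE.
  have rowE k' j' : row k' (T x) 0 j' = T x k' j' by rewrite mxE.
  by congr (_ - _); rewrite (entryZ _ _ k a) (entryZ _ _ j a) !outer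
    !rowE addrC.
- move=> j /=; rewrite Et trmxD trmxN mulmxDl mulmxDr mulNmx mulmxN.
  rewrite addrACA hess_lift// -opprD.
  apply/eqP; rewrite subr_eq0; apply/eqP; rewrite /model_hess.
  rewrite !(trmxD, trmxN, trmxZ) !trmx_mul trmxK !(mulmxDl, mulmxDr, mulNmx,
    mulmxN).
  have TPT : (T x)^T *m (P x *m T x) = s x ^+ 2 *: Q x.
    by rewrite mulmxA -lift_jacobian// liftE.
  have dPT : dlog x *m (P x *m T x) = 0 by rewrite mulmxA glog_jacobian.
  rewrite -!mulmxA dPT mulmx0 addr0 -scalemxAl !TPT -!scalemxAr.
  rewrite lift_jacobian//.
  rewrite !(mulmxA (lift x)) gT' mul0mx addr0 lift_jacobian// -scalemxAl.
  have -> : \sum_b T x j b *: ((conn H b (theta x))^T *m Q x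
      + Q x *m conn H b (theta x)) = (pullback_conn j x)^T *m Q x
        + Q x *m pullback_conn j x.
    rewrite /pullback_conn raddf_sum /= mulmx_suml mulmx_sumr -big_split /=.
    by apply: eq_bigr => b _; rewrite trmxZ -scalemxAl -scalemxAr scalerDr.
  by mx_linear.
- rewrite Et lift_jacobian// unitmxZ.
    by rewrite unitmx_inv Hunit//; exact: UV.
  by rewrite unitrX// unitfE s0.
- move=> u v uT vT; rewrite alongB mulmxBr HV// along_model_hess//.
  by rewrite -scalemxAr vT scaler0 subrr.
- move=> u uT; rewrite Et alongB mulmxBr trmxD trmxN HM//; congr (_ - _).
  by rewrite along_model_hess// -scalemxAr lift_jacobian// scalerA trmxZ QsymT.
Qed.

Section Curvature.
Hypothesis hessE : forall x, U x -> forall i, hess G theta i x = model_hess i x.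

Lemma covariant_lift_model i x : U x -> covariant G lift i x =
  dlog x 0 i *: lift x + (partial i theta x)^T *m glog x - (pullback_conn i x)^T
    *m lift x.
Proof.
move=> Ux; rewrite covariant_lift// hessE// /model_hess liftE !(trmxD, trmxN,
  trmxZ) !trmx_mul trmxK.
rewrite !(mulmxDl, mulNmx) -scalemxAl -!mulmxA.
by rewrite (row_jacobian _ (smooth_differentiable Sth Ux)).
Qed.

Lemma pullback_conn_smooth i : smooth_on U (pullback_conn i).
Proof.
apply/(smooth_mxP _ oU) => j k.
apply: (smooth_eq oU (f := fun x => \sum_b T x i b * conn H b (theta x) j k)).
  by move=> x _; rewrite /pullback_conn summxE; apply: eq_bigr => b _;
    rewrite entryZ.
apply: smooth_sum => // b; apply: smoothM => //; first exact: smooth_entry.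
apply: (smooth_entry oU (A := fun x => conn H b (theta x))).
apply: (smooth_comp oU oV UV Sth); exact: conn_smooth.
Qed.

Lemma partial_pullback_conn i j x : U x -> partial i (pullback_conn j) x =
  \sum_b (partial i (partial j theta) x 0 b *: conn H b (theta x)
  + T x j b *: \sum_c T x i c *: partial c (conn H b) (theta x)).
Proof.
move=> Ux; have Vx := UV Ux.
have SHb b : smooth_on V (conn H b) by exact: conn_smooth.
have SHt b : smooth_on U (fun x => conn H b (theta x)).
  exact: (smooth_comp oU oV UV Sth (SHb b)).
have STb b : smooth_on U (fun x => T x j b) by exact: smooth_entry.
rewrite /pullback_conn partialE derive_summx => [|b]; last first.
  apply: differentiable_scalemx; first exact: smooth_differentiable (STb b) Ux.
  exact: smooth_differentiable (SHt b) Ux.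
apply: eq_bigr => b _.
transitivity (partial i (fun y => T y j b *: conn H b (theta y)) x).
  by rewrite partial.unlock.
rewrite (partial_scale i (STb b) (SHt b) Ux).
rewrite (partial_comp i Sth (SHb b) Ux Vx)
  -(partial_jacobian_sym i j b oU Sth Ux).
by rewrite (partial_entry i j b ST Ux).
Qed.

(** The second derivatives of [theta] cancel by symmetry, which leaves the
pullback of the curvature of the base. *)
Lemma pullback_conn_curvature i j x : U x ->
  partial i (pullback_conn j) x - partial j (pullback_conn i) x
    + pullback_conn j x *m pullback_conn i x
    - pullback_conn i x *m pullback_conn j x
  = \sum_b \sum_c (T x j b * T x i c) *: curvature H c b (theta x).
Proof.
move=> Ux.
have cc k l : pullback_conn k x *m pullback_conn l x =
  \sum_b \sum_c (T x k b * T x l c) *: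
    (conn H b (theta x) *m conn H c (theta x)).
  rewrite /pullback_conn mulmx_suml; apply: eq_bigr => b _.
  rewrite mulmx_sumr; apply: eq_bigr => c _.
  by rewrite -scalemxAl -scalemxAr scalerA.
rewrite !partial_pullback_conn// (partial_commute oU i j Sth Ux) !big_split /=.
rewrite opprD addrACA subrr add0r.
have dd k l : \sum_b T x k b *:
  (\sum_c T x l c *: partial c (conn H b) (theta x)) =
   \sum_b \sum_c (T x k b * T x l c) *: partial c (conn H b) (theta x).
  by apply: eq_bigr => b _; rewrite scaler_sumr; apply: eq_bigr => c _;
    rewrite scalerA.
have dd' k l : \sum_b T x k b *:
  (\sum_c T x l c *: partial c (conn H b) (theta x)) =
   \sum_b \sum_c (T x k c * T x l b) *: partial b (conn H c) (theta x).
  by rewrite dd exchange_big.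
have cc' k l : pullback_conn k x *m pullback_conn l x =
  \sum_b \sum_c (T x k c * T x l b) *:
    (conn H c (theta x) *m conn H b (theta x)).
  by rewrite cc exchange_big.
rewrite (dd j i) (dd' i j) (cc j i) (cc' i j).
rewrite -sumrB -big_split -sumrB; apply: eq_bigr => b _ /=.
rewrite -sumrB -big_split -sumrB; apply: eq_bigr => c _ /=.
rewrite /curvature; mx_linear.
Qed.

(** The Ricci identity for the gradients of the components of [theta], whose
covariant derivatives are known from [hess_eq_model]. *)
Lemma lift_curvature i j x : U x -> lift x *m curvature G i j x =
  (dlog x 0 j *: (partial i theta x)^T - dlog x 0 i *: (partial j theta x)^T)
    *m glog x
  + (partial j theta x)^T *m covariant G glog i x - (partial i theta x)^T
    *m covariant G glog j x
  - (\sum_b \sum_c (T x j b * T x i c) *: curvature H c b (theta x))^T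
    *m lift x.
Proof.
move=> Ux; rewrite -(ricci_identity oU SG Gunit i j lift_smooth Ux)
  -pullback_conn_curvature//.
have Sd k : smooth_on U (fun y => dlog y 0 k).
  by apply: smooth_entry => //; exact: dlog_smooth.
have Sp k : smooth_on U (fun y => (partial k theta y)^T).
  by apply: smooth_trmx => //; exact: partial_smooth.
have Sc k : smooth_on U (fun y => - (pullback_conn k y)^T).
  apply: (smooth_eq oU (f := fun y => (-1) *: (pullback_conn k y)^T)).
    by move=> y _; rewrite scaleN1r.
  apply: smooth_scalemx => //; first exact: smooth_cst.
  by apply: smooth_trmx => //; exact: pullback_conn_smooth.
have E k l : covariant G (covariant G lift l) k x =
    pd k (fun y => dlog y 0 l) x *: lift x + dlog x 0 l *: covariant G lift k x
    + ((partial k (partial l theta) x)^T *m glog x + (partial l theta x)^T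
      *m covariant G glog k x)
    - ((partial k (pullback_conn l) x)^T *m lift x + (pullback_conn l x)^T
      *m covariant G lift k x).
  rewrite (covariant_eq (U := U) G (N := fun y => dlog y 0 l *: lift y
     + (partial l theta y)^T *m glog y + (- (pullback_conn l y)^T) *m lift y) oU
       k Ux); last first.
    by move=> y Uy; rewrite covariant_lift_model// mulNmx.
  have S1 : smooth_on U (fun y => dlog y 0 l *: lift y).
    by apply: smooth_scalemx => //; exact: lift_smooth.
  have S2 : smooth_on U (fun y => (partial l theta y)^T *m glog y).
    by apply: smooth_mulmx => //; exact: glog_smooth.
  have S3 : smooth_on U (fun y => (- (pullback_conn l y)^T) *m lift y).
    by apply: smooth_mulmx => //; exact: lift_smooth.
  rewrite (covariant_add G k (smoothD oU S1 S2) S3 Ux) (covariant_add G k S1 S2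
    Ux).
  rewrite (covariant_scale G k (Sd l) lift_smooth Ux).
  rewrite (covariant_mul G k (Sp l) glog_smooth Ux) (covariant_mul G k (Sc l)
    lift_smooth Ux).
  rewrite (partial_trmx k (partial_smooth l Sth) Ux).
  have -> : partial k (fun y => - (pullback_conn l y)^T) x =
    - (partial k (pullback_conn l) x)^T.
    rewrite -(partial_trmx k (pullback_conn_smooth l) Ux) partialE
      partial.unlock.
    apply: deriveN; apply: diff_derivable; apply: differentiable_trmx.
    exact: smooth_differentiable (pullback_conn_smooth l) Ux.
  by rewrite !mulNmx -opprD.
have Ct : (pullback_conn j x)^T *m (partial i theta x)^T = (pullback_conn i x)^T
  *m (partial j theta x)^T.
  have dth := smooth_differentiable Sth Ux.
  by rewrite -!trmx_mul -!(row_jacobian _ dth) pullback_conn_torsion.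
rewrite (E i j) (E j i) (log_diff_closed oU Ss s0 i j Ux) (partial_commute oU i
  j Sth Ux).
rewrite !covariant_lift_model// !(trmxD, trmxN) !trmx_mul.
rewrite !(mulmxDl, mulmxDr, mulNmx, mulmxN, scalerDr, scalerN) -!scalemxAl
  -!scalemxAr.
rewrite !mulmxA Ct.
mx_linear.
Qed.

(** The covariant derivative of [glog_jacobian]; the contribution of the
Hessian reduces to the square of the norm of the gradient of [ln s]. *)
Lemma covariant_glog_jacobian j x : U x ->
  covariant G glog j x *m T x = - (glog x *m (dlog x)^T) *m row j (T x).
Proof.
move=> Ux; apply/eqP; rewrite mulNmx -addr_eq0; apply/eqP.
have : partial j (fun y => glog y *m T y) x = 0.
  rewrite (partial_eq oU j Ux (B := fun=> 0)); last exact: glog_jacobian.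
  by rewrite partialE derive_cst.
rewrite (partial_mul j glog_smooth ST Ux) partial_jacobian hessE// /model_hess
  => e.
rewrite -[RHS]e covariantE !(mulmxDr, mulmxDl, mulmxN) -scalemxAr !mulmxA.
by rewrite glog_jacobian// scaler0 !mul0mx; mx_linear.
Qed.

(** The trace of [lift_curvature]. Its terms in the square of the norm of the
gradient of [ln s] cancel by [covariant_glog_jacobian]. Moreover
[curvature_skew] exchanges the two indices of the curvature of the base that
the gradients leave free, which makes its contraction the Ricci tensor. *)
Lemma lift_ricci_mx lambda x : U x ->
  ricci_mx H (theta x) = lambda *: H (theta x) ->
  lift x *m (ricci_mx G x)^T = (log_laplacian G s x + lambda * s x ^+ 2) *:
    (T x)^T.
Proof.
move=> Ux HE; have Vx := UV Ux; apply/matrixP => a j; rewrite mul_ricci_mx.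
have dth := smooth_differentiable Sth Ux.
have rT i : partial i theta x 0 a = T x i a by rewrite -row_jacobian// mxE.
have outer (u : 'rV[R]_m) (v : 'rV[R]_n) i : (u^T *m v) a i = u 0 a * v 0 i.
  by rewrite mxE big_ord1 mxE.
have gT0 : \sum_i T x i a * glog x 0 i = 0.
  have /rowP/(_ a) := glog_jacobian Ux.
  by rewrite !mxE => {2}<-; apply: eq_bigr => i _; rewrite mulrC.
have t1 i : (lift x *m curvature G i j x) a i =
   dlog x 0 j * (T x i a * glog x 0 i) - T x j a * (dlog x 0 i * glog x 0 i)
   + T x j a * covariant G glog i x 0 i - T x i a * covariant G glog j x 0 i
   - \sum_b \sum_c (T x j b * T x i c) * ((curvature H c b (theta x))^T
     *m lift x) a i.
  rewrite lift_curvature// !(entryD, entryN) mulmxBl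
    -!scalemxAl !(entryD, entryN).
  rewrite 2!entryZ !outer !rT raddf_sum /= mulmx_suml summxE.
  congr (_ - _); last first.
    apply: eq_bigr => b _; rewrite raddf_sum /= mulmx_suml summxE.
    by apply: eq_bigr => c _; rewrite trmxZ -scalemxAl entryZ.
  by ring.
under eq_bigr do rewrite t1.
rewrite 2!sumrB big_split sumrB /= -!mulr_sumr gT0 mulr0 sub0r.
have -> : \sum_i T x i a * covariant G glog j x 0 i =
    - (\sum_i dlog x 0 i * glog x 0 i) * T x j a.
  have /rowP/(_ a) := covariant_glog_jacobian j Ux.
  rewrite mulNmx entryN mulNr mxE [in X in _ = X -> _]mxE big_ord1.
  rewrite (_ : row j (T x) 0 a = T x j a); last by rewrite mxE.
  move=> e.
  transitivity (\sum_i covariant G glog j x 0 i * T x i a).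
    by apply: eq_bigr => i _; rewrite mulrC.
  rewrite e; congr (- (_ * _)); rewrite mxE.
  by apply: eq_bigr => i _; rewrite [_^T _ _]mxE mulrC.
have -> : \sum_i \sum_b \sum_c (T x j b * T x i c) *
      ((curvature H c b (theta x))^T *m lift x) a i = - (lambda * s x ^+ 2)
        * T x j a.
  rewrite exchange_big /=.
  have e b : \sum_i \sum_c (T x j b * T x i c) *
      ((curvature H c b (theta x))^T *m lift x) a i =
      T x j b * - (s x ^+ 2 * (Q x *m (ricci_mx H (theta x))^T) a b).
    rewrite mul_ricci_mx exchange_big mulr_sumr -sumrN mulr_sumr /=.
    apply: eq_bigr => c _.
    transitivity (T x j b * ((curvature H c b (theta x))^T *m lift x *m T x) a
      c).
      rewrite [X in _ = _ * X]mxE mulr_sumr; apply: eq_bigr => i _.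
      by rewrite [in LHS]mulrAC -mulrA.
    rewrite -mulmxA lift_jacobian// -scalemxAr entryZ.
    by rewrite (curvature_skew oV SH Hsym Hunit)// entryN mulrN.
  under eq_bigr do rewrite e.
  rewrite HE trmxZ Hsym -scalemxAr mulVmx ?Hunit//.
  rewrite (bigD1 a)//= big1 ?addr0 => [|b ba].
    by rewrite entryZ [1%:M _ _]mxE eqxx mulr1; ring.
  by rewrite entryZ [1%:M _ _]mxE eq_sym (negPf ba) !mulr0 oppr0 mulr0.
rewrite entryZ [_^T _ _]mxE /log_laplacian; ring.
Qed.

End Curvature.
End ConformalSubmersion.

(** * Changes of coordinates *)

Section Isometry.
Variables (R : realType) (n : nat) (U V : set 'rV[R]_n).
Variables (G H : 'rV[R]_n -> 'M[R]_n) (psi : 'rV[R]_n -> 'rV[R]_n).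
Hypothesis C : local_conformal U V G H psi (fun=> 1).
Hypothesis J_unit : forall x, U x -> 'J psi x \in unitmx.

(** An invertible differential leaves no vertical vectors, so the conditions
of [hess_eq_model] on them hold trivially. *)
Lemma christoffel_law i x : U x ->
  partial i (fun y => 'J psi y) x =
  conn G i x *m 'J psi x - 'J psi x *m pullback_conn H psi i x.
Proof.
move=> Ux.
have inj (u : 'rV[R]_n) : u *m 'J psi x = 0 -> u = 0.
  by move=> /(congr1 (mulmx^~ (invmx ('J psi x)))); rewrite mulmxK ?J_unit//
    mul0mx.
have along0 D : along D (0 : 'rV[R]_n) = 0 :> 'M[R]_n.
  by rewrite /along big1// => k _; rewrite mxE scale0r.
rewrite (partial_jacobian G) (hess_eq_model C Ux) /model_hess.
- have -> : log_diff (fun=> 1) x = 0 :> 'rV[R]_n.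
    by apply/rowP => k; rewrite !mxE /pd derive_cst mulr0.
  by rewrite mxE scale0r trmx0 mul0mx; mx_linear.
- by move=> u v /inj -> _; rewrite along0 mulmx0.
- by move=> u /inj ->; rewrite along0 mulmx0 trmx0.
Qed.

(** The gradients of [ln s] and of [ln s'] are related by [psi]. By
[christoffel_law] so are their covariant derivatives, which are then conjugate
matrices and have the same trace. *)
Lemma log_laplacian_isometry (s s' : 'rV[R]_n -> R) x :
  smooth_on U s -> smooth_on V s' -> (forall y, V y -> s' y != 0) ->
  (forall y, U y -> s y = s' (psi y)) -> U x ->
  log_laplacian G s x = log_laplacian H s' (psi x).
Proof.
move=> Ss Ss' s'0 ss' Ux.
have oU := lc_openU C; have oV := lc_openV C; have UV := lc_maps C.
have Sp := lc_theta C; have SG := lc_G C; have SH := lc_H C.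
have s0 y : U y -> s y != 0 by move=> Uy; rewrite ss'//; exact/s'0/UV.
have SJ := jacobian_smooth oU Sp.
have Sg := log_grad_smooth oU Ss SG s0 (lc_Gunit C).
have Sh := log_grad_smooth oV Ss' SH s'0 (lc_Hunit C).
have E y : U y -> log_grad G s y *m 'J psi y = log_grad H s' (psi y).
  move=> Uy.
  have Jy := J_unit Uy.
  have -> : log_grad H s' (psi y) =
     log_diff s' (psi y) *m (('J psi y)^T *m invmx (G y) *m 'J psi y).
    by rewrite (lc_cometric C Uy) expr1n scale1r.
  rewrite /log_grad !mulmxA; congr (_ *m _ *m _).
  have -> : log_diff s y = (s y)^-1 *: \row_i pd i (s' \o psi) y.
    apply/rowP => i; rewrite !mxE; congr (_ * _); apply: near_eq_derive.
    by apply: (open_eq_near oU Uy) => z Uz; rewrite ss'.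
  rewrite (gradient_comp Sp Ss' Uy (UV _ Uy)) scalemxAl ss'//; congr (_ *m _).
  by apply/rowP => i; rewrite !mxE.
have E2 i : covariant G (log_grad G s) i x *m 'J psi x =
    \sum_b 'J psi x i b *: covariant H (log_grad H s') b (psi x).
  have -> : \sum_b 'J psi x i b *: covariant H (log_grad H s') b (psi x) =
      \sum_b 'J psi x i b *: partial b (log_grad H s') (psi x)
      + log_grad H s' (psi x) *m pullback_conn H psi i x.
    rewrite /pullback_conn mulmx_sumr -big_split; apply: eq_bigr => b _ /=.
    by rewrite covariantE scalerDr scalemxAr.
  have := partial_eq oU i Ux E; rewrite (partial_mul i Sg SJ Ux).
  rewrite (partial_comp i Sp Sh Ux (UV _ Ux)) christoffel_law// => <-.
  by rewrite covariantE mulmxDl mulmxBr !mulmxA E//; mx_linear.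
pose M := \matrix_(i, k) covariant G (log_grad G s) i x 0 k.
pose M' := \matrix_(i, k) covariant H (log_grad H s') i (psi x) 0 k.
have EM : M *m 'J psi x = 'J psi x *m M'.
  apply/row_matrixP => i; rewrite !row_mul.
  have -> : row i M = covariant G (log_grad G s) i x by apply/rowP => k;
    rewrite !mxE.
  rewrite E2; apply/rowP => k; rewrite summxE [RHS]mxE; apply: eq_bigr => b _.
  by rewrite entryZ; congr (_ * _); rewrite [RHS]mxE.
have trE : \tr M = \tr M'.
  by rewrite -(mulmxK (J_unit Ux) M) EM mxtrace_mulC mulKmx ?J_unit.
rewrite /log_laplacian; move: trE; rewrite /mxtrace.
by under eq_bigr do rewrite mxE; under [in X in _ = X ->
  _]eq_bigr do rewrite mxE.
Qed.

End Isometry.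

(** * Integral manifolds of the horizontal distribution *)

Section Integrable.
Variables (R : realType) (n m : nat) (U : set 'rV[R]_n) (V : set 'rV[R]_m).
Variables (G : 'rV[R]_n -> 'M[R]_n) (H : 'rV[R]_m -> 'M[R]_m).
Variables (theta : 'rV[R]_n -> 'rV[R]_m) (s : 'rV[R]_n -> R).
Hypothesis C : local_conformal U V G H theta s.
Variables (W : set 'rV[R]_m) (F : 'rV[R]_m -> 'rV[R]_n).
Variables (K : 'rV[R]_m -> 'M[R]_m) (w : 'rV[R]_m).
Hypotheses (oW : open W) (Ww : W w) (SF : smooth_on W F) (SK : smooth_on W K).
Hypothesis WU : forall y, W y -> U (F y).
Hypothesis JF : forall y, W y -> 'J F y = K y *m hlift G theta (F y).
Hypothesis Kw : K w \in unitmx.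

(** Along an integral manifold [F] of the horizontal distribution one has
['J F *m G = K *m ('J theta)^T]. Differentiate this along [F] and contract
with the vertical vector [v]: the second derivatives of [F] and the
Christoffel terms are symmetric in the two directions along [F], hence so is
what remains, the Hessian of [theta] on [v] and a horizontal vector. *)
Lemma integrable_mixed (v : 'rV[R]_n) : v *m 'J theta (F w) = 0 ->
  (hlift G theta (F w) *m along (fun i => hess G theta i (F w)) v)^T =
  hlift G theta (F w) *m along (fun i => hess G theta i (F w)) v.
Proof.
move=> vT; set x := F w; set D := along _ v; set N := hlift G theta x.
have Ux : U x by exact: WU.
have oU := lc_openU C; have Sth := lc_theta C; have SG := lc_G C.
have ST := jacobian_smooth oU Sth.
have SJF := jacobian_smooth oW SF.
have SGF : smooth_on W (fun y => G (F y)) by exact: (smooth_comp oW oU WU SF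
  SG).
have STF : smooth_on W (fun y => 'J theta (F y)) by exact: (smooth_comp oW oU WU
  SF ST).
have STFt := smooth_trmx oW STF.
have E y : W y -> 'J F y *m G (F y) = K y *m ('J theta (F y))^T.
  move=> Wy; rewrite JF// liftE -!mulmxA mulVmx ?mulmx1//.
  exact/(lc_Gunit C)/WU.
have dE c := partial_eq oW c Ww E.
set DF := 'J F w; set Kw' := K w; set g := G x *m v^T.
have EFG : DF *m G x = Kw' *m ('J theta x)^T by exact: E.
have second c : partial c (fun y => 'J F y) w *m g =
    \sum_k DF c k *: (Kw' *m (hess G theta k x)^T *m v^T
      - DF *m conn G k x *m g).
  have := dE c; rewrite (partial_mul c SJF SGF Ww) (partial_mul c SK STFt Ww).
  rewrite (partial_trmx c STF Ww) (partial_comp c SF SG Ww Ux) (partial_comp c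
    SF ST Ww Ux).
  have vT' : ('J theta x)^T *m v^T = 0 by rewrite -trmx_mul vT trmx0.
  move=> /(congr1 (mulmx^~ v^T)); rewrite !mulmxDl.
  rewrite -(mulmxA (partial c K w)) vT' mulmx0 add0r -(mulmxA (partial c _ w))
    -/g.
  move=> /(canRL (addrK _)) ->; rewrite raddf_sum !mulmx_sumr !mulmx_suml
    -sumrB.
  apply: eq_bigr => k _ /=.
  rewrite trmxZ -!scalemxAr -!scalemxAl -scalerBr; congr (_ *: _).
  rewrite (partial_jacobian G) (conn_compat SG (lc_Gsym C) (lc_Gunit C))//.
  rewrite trmxD trmx_mul !mulmxDr !mulmxDl /g !mulmxA EFG.
  by mx_linear.
have second_sym a c : (partial c (fun y => 'J F y) w *m g) a 0 =
    (partial a (fun y => 'J F y) w *m g) c 0.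
  rewrite !mxE; apply: eq_bigr => l _; congr (_ * _).
  rewrite (partial_jacobian_sym c a l oW SF Ww) (partial_jacobian_sym a c l oW
    SF Ww).
  by rewrite (partial_commute oW c a SF Ww).
have chr_sym a c : \sum_k DF c k * (DF *m conn G k x *m g) a 0 =
    \sum_k DF a k * (DF *m conn G k x *m g) c 0.
  have e a' k : (DF *m conn G k x *m g) a' 0 =
      \sum_j DF a' j * \sum_l (conn G k x j l * g l 0).
    by rewrite -mulmxA mxE; apply: eq_bigr => j _; rewrite [X in _ * X]mxE.
  under eq_bigr do rewrite e mulr_sumr.
  under [RHS]eq_bigr do rewrite e mulr_sumr.
  rewrite exchange_big; apply: eq_bigr => j _; apply: eq_bigr => k _ /=.
  under eq_bigr do rewrite (conn_torsion (lc_Gsym C)).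
  by ring.
have Y c a : (DF *m D *m Kw'^T) c a =
    \sum_k DF c k * (Kw' *m (hess G theta k x)^T *m v^T) a 0.
  rewrite -mulmxA mxE; apply: eq_bigr => k _; congr (_ * _).
  rewrite -mulmxA !mxE; apply: eq_bigr => b _; rewrite mulrC [Kw'^T _ _]mxE.
  congr (_ * _); rewrite /D /along summxE [RHS]mxE; apply: eq_bigr => j _.
  by rewrite !mxE (hess_sym C j k b Ux) mulrC.
have Ysym : (DF *m D *m Kw'^T)^T = DF *m D *m Kw'^T.
  apply/matrixP => c a; rewrite mxE !Y.
  have col a' c' : (partial c' (fun y => 'J F y) w *m g) a' 0 =
      \sum_k DF c' k * (Kw' *m (hess G theta k x)^T *m v^T) a' 0
      - \sum_k DF c' k * (DF *m conn G k x *m g) a' 0.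
    rewrite second summxE -sumrB; apply: eq_bigr => k _.
    by rewrite entryZ entryD entryN mulrBr.
  have := second_sym c a; rewrite (col c a) (col a c) (chr_sym c a) => /addIr.
  exact.
have DE : DF = Kw' *m N by exact: JF.
have Kt : Kw'^T \in unitmx by rewrite unitmx_tr.
apply: (can_inj (mulKmx Kw)); apply: (can_inj (mulmxK Kt)).
rewrite -/Kw' mulmxA -DE -Ysym DE !trmx_mul trmxK; by rewrite !mulmxA.
Qed.

End Integrable.

(** * Changes of coordinates and the Hessian of a submersion *)

Section HessChange.
Variables (R : realType) (n m : nat) (U V : set 'rV[R]_n).
Variables (G H : 'rV[R]_n -> 'M[R]_n) (psi : 'rV[R]_n -> 'rV[R]_n).
Hypothesis C : local_conformal U V G H psi (fun=> 1).
Hypothesis J_unit : forall x, U x -> 'J psi x \in unitmx.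
Variables (U' V' : set 'rV[R]_n) (theta theta' : 'rV[R]_n -> 'rV[R]_m).
Variable B : 'rV[R]_n -> 'M[R]_m.
Hypotheses (oU' : open U') (oV' : open V') (UU' : U' `<=` U).
Hypothesis UV' : forall y, U' y -> V' (psi y).
Hypotheses (Sth' : smooth_on V' theta') (SB : smooth_on U' B).
Hypothesis JE : forall y, U' y ->
  'J theta y = 'J psi y *m 'J theta' (psi y) *m B y.

(** [B] is the differential of the change of coordinates in the base. The
second derivatives of [psi] are absorbed by [christoffel_law]; those of the
change of coordinates in the base, contained in the derivative of [B], are
multiplied by the image of [v], which is zero. *)
Lemma hess_change x (u v : 'rV[R]_n) : U' x ->
  v *m 'J psi x *m 'J theta' (psi x) = 0 ->
  v *m along (fun i => hess G theta i x) u =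
  (v *m 'J psi x) *m along (fun i => hess H theta' i (psi x)) (u *m 'J psi x)
    *m B x.
Proof.
move=> Ux vT; have Vx := UV' Ux.
have Sp : smooth_on U' psi by exact: smooth_subset UU' (lc_theta C).
have SJ := jacobian_smooth oU' Sp.
have ST := jacobian_smooth oV' Sth'.
have STp : smooth_on U' (fun y => 'J theta' (psi y)) by exact: (smooth_comp oU'
  oV' UV' Sp ST).
have E i : v *m hess G theta i x =
    \sum_b 'J psi x i b *: (v *m 'J psi x *m hess H theta' b (psi x) *m B x).
  rewrite {1}hess.unlock (partial_eq oU' i Ux JE).
  rewrite (partial_mul i (smooth_mulmx oU' SJ STp) SB Ux) (partial_mul i SJ STp
    Ux).
  rewrite (partial_comp i Sp ST Ux Vx) (christoffel_law C J_unit i (UU' Ux))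
    JE//.
  rewrite !(mulmxDl, mulmxDr, mulmxN, mulNmx) !mulmxA vT mul0mx addr0.
  have cancel (X Y Z : 'M[R]_(1, m)) : X - Y + Z - X = Z - Y by mx_linear.
  rewrite cancel /pullback_conn.
  rewrite !(mulmx_sumr, mulmx_suml) -sumrB; apply: eq_bigr => b _.
  rewrite -!scalemxAr -!scalemxAl -scalerBr; congr (_ *: _).
  by rewrite hess.unlock mulmxBr mulmxBl !mulmxA.
rewrite /along mulmx_sumr.
under eq_bigr do rewrite -scalemxAr E scaler_sumr.
rewrite exchange_big mulmx_sumr mulmx_suml; apply: eq_bigr => b _ /=.
under eq_bigr do rewrite scalerA.
rewrite -scaler_suml -scalemxAr -scalemxAl; congr (_ *: _).
by rewrite mxE.
Qed.

End HessChange.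

Lemma invmx_congruence (R : realType) n (A G : 'M[R]_n) :
  A \in unitmx -> G \in unitmx ->
  A^T *m invmx (A *m G *m A^T) = invmx G *m invmx A.
Proof.
move=> uA uG; have uK : A *m G *m A^T \in unitmx.
  by rewrite !unitmx_mul uA uG unitmx_tr.
apply: (can_inj (mulmxK uK)); rewrite mulmxKV//.
by rewrite !mulmxA mulmxKV// mulVmx// mul1mx.
Qed.

Lemma jacobian_comp (R : realType) n m k (f : 'rV[R]_n -> 'rV[R]_m)
    (g : 'rV[R]_m -> 'rV[R]_k) x :
  differentiable f x -> differentiable g (f x) ->
  'J (g \o f) x = 'J f x *m 'J g (f x).
Proof.
move=> df dg; apply/row_matrixP => i; rewrite row_mul rowE -derivemxE;
  last first.
  exact: differentiable_comp.
rewrite derive_comp_rV// mulmx_sum_row; apply: eq_bigr => b _.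
by rewrite mxE jacobianE// [row b _]rowE -derivemxE.
Qed.

Lemma jacobian_eq (R : realType) n m (U : set 'rV[R]_n) (f g : 'rV[R]_n ->
  'rV[R]_m) x :
  open U -> U x -> (forall y, U y -> f y = g y) -> differentiable f x ->
  'J f x = 'J g x.
Proof.
move=> oU Ux fg df; have [dg _] := near_eq_diff (open_eq_near oU Ux fg) df.
apply/row_matrixP => i.
apply: etrans (row_jacobian i df) (etrans _ (esym (row_jacobian i dg))).
rewrite partial.unlock.
exact: near_eq_derive (open_eq_near oU Ux fg).
Qed.

Lemma jacobian_id (R : realType) n (U : set 'rV[R]_n) (f : 'rV[R]_n ->
  'rV[R]_n) x :
  open U -> U x -> (forall y, U y -> f y = y) -> 'J f x = 1%:M.
Proof.
move=> oU Ux fg; rewrite -(@jacobian_eq _ _ _ U id)//; last by move=> y /fg.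
by apply/row_matrixP => i; rewrite rowE -derivemxE// derive_id row1.
Qed.

Lemma open_preimage (T T' : topologicalType) (U : set T) (W : set T') (f : T ->
  T') :
  open U -> open W -> (forall x, U x -> {for x, continuous f}) ->
  open (U `&` f @^-1` W).
Proof.
move=> oU oW cf; rewrite openE => x [Ux Wx]; rewrite /interior.
apply: filterI; first exact: open_nbhs_nbhs.
by apply: (cf x Ux); exact: open_nbhs_nbhs.
Qed.

(** * Transition maps *)

Section Charts.
Variables (R : realType) (n : nat) (M : manifold R n).
Implicit Types p q r : M.

Definition transition p q : 'rV[R]_n -> 'rV[R]_n := chart q \o param p.
Definition overlap p q : set 'rV[R]_n := chart p @` (chart_dom p `&`
  chart_dom q).

Lemma chart_img_param p x : chart_img p x ->
  chart_dom p (param p x) /\ chart p (param p x) = x.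
Proof. by move=> [q pq <-]; rewrite chartK. Qed.

Lemma chart_in p q : chart_dom p q -> chart_img p (chart p q).
Proof. by move=> pq; exists q. Qed.

Lemma center_in p : chart_img p (chart p p).
Proof. exact/chart_in/chart_dom_center. Qed.

Lemma overlapE p q : overlap p q = chart_img p `&` param p @^-1` chart_dom q.
Proof.
apply/seteqP; split => [x [r [pr qr] <-]|x [px qx]].
  by split; [exact: chart_in|rewrite /= chartK].
have [dx ex] := chart_img_param px.
by exists (param p x).
Qed.

Lemma overlapP p q x : chart_img p x -> chart_dom q (param p x) ->
  overlap p q x.
Proof. by rewrite overlapE. Qed.

Lemma image_dom_open p (O : set M) : open O ->
  open (chart p @` (O `&` chart_dom p)).
Proof.
move=> oO.
rewrite (_ : _ @` _ = chart_img p `&` param p @^-1` O).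
  apply: open_preimage => //; first exact: chart_img_open.
  exact: param_continuous.
apply/seteqP; split => [x [r [Or pr] <-]|x [px Ox]].
  by split; [exact: chart_in|rewrite /= chartK].
have [dx ex] := chart_img_param px.
by exists (param p x).
Qed.

Lemma overlap_open p q : open (overlap p q).
Proof. by rewrite /overlap setIC; apply: image_dom_open; exact: chart_dom_open.
Qed.

Lemma transition_smooth p q : smooth_on (overlap p q) (transition p q).
Proof. exact: chart_compat. Qed.

Lemma overlap_img p q x : overlap p q x -> chart_img p x.
Proof. by rewrite overlapE => -[]. Qed.

Lemma overlap_dom p q x : overlap p q x -> chart_dom q (param p x).
Proof. by rewrite overlapE => -[]. Qed.

Lemma param_transition p q x : overlap p q x -> param q (transition p q x) =
  param p x.
Proof. by move=> /overlap_dom qx; rewrite /transition /= chartK. Qed.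

Lemma transition_ov p q x : overlap p q x -> overlap q p (transition p q x).
Proof.
move=> ox; apply: overlapP; first by apply: chart_in; exact: overlap_dom ox.
by rewrite param_transition//; have [] := chart_img_param (overlap_img ox).
Qed.

Lemma transition_transition p q r x : overlap p q x ->
  transition q r (transition p q x) = transition p r x.
Proof. by move=> ox; rewrite {1}/transition /= param_transition. Qed.

Lemma overlap_ov p q r x : overlap p q x -> overlap p r x ->
  overlap q r (transition p q x).
Proof.
move=> oq or; apply: overlapP; first by apply: chart_in; exact: overlap_dom oq.
by rewrite param_transition//; exact: overlap_dom or.
Qed.

Lemma transition_differentiable p q x : overlap p q x ->
  differentiable (transition p q) x.
Proof. exact: smooth_differentiable (@transition_smooth p q). Qed.

Lemma jacobian_cocycle p q r x : overlap p q x -> overlap p r x ->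
  'J (transition p r) x = 'J (transition p q) x *m 'J (transition q r)
    (transition p q x).
Proof.
move=> oq or; have oqr := overlap_ov oq or.
rewrite -jacobian_comp; [|exact: transition_differentiable|exact:
  transition_differentiable].
apply/esym; apply: (jacobian_eq (@overlap_open p q) oq).
  by move=> y oy; rewrite /= transition_transition.
by apply: differentiable_comp; exact: transition_differentiable.
Qed.

Lemma overlap_self p x : chart_img p x -> overlap p p x.
Proof. by move=> px; apply: overlapP => //; have [] := chart_img_param px. Qed.

Lemma jacobian_self p x : chart_img p x -> 'J (transition p p) x = 1%:M.
Proof.
move=> px; apply: (jacobian_id (@chart_img_open _ _ M p) px) => y py.
by rewrite /transition /=; have [] := chart_img_param py.
Qed.

Lemma jacobian_transitionK p q x : overlap p q x ->
  'J (transition p q) x *m 'J (transition q p) (transition p q x) = 1%:M.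
Proof.
move=> oq; rewrite -jacobian_cocycle//; last exact/overlap_self/overlap_img/oq.
exact/jacobian_self/overlap_img/oq.
Qed.

Lemma jacobian_transition_unit p q x : overlap p q x -> 'J (transition p q) x
  \in unitmx.
Proof. by move=> /jacobian_transitionK /mulmx1_unit [uA _]; exact: uA. Qed.

Section Forms.
Variable g : metric M.

Lemma form_inE p x : form_in g p x =
  'J (transition p (param p x)) x *m g (param p x)
    *m ('J (transition p (param p x)) x)^T.
Proof. by []. Qed.

Lemma form_in_sym p x : (form_in g p x)^T = form_in g p x.
Proof. by rewrite form_inE !trmx_mul trmxK gram_sym mulmxA. Qed.

Lemma overlap_param p x : chart_img p x -> overlap p (param p x) x.
Proof. by move=> px; apply: overlapP => //; exact: chart_dom_center. Qed.

Lemma gram_unit p : g p \in unitmx.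
Proof.
rewrite -row_free_unit -kermx_eq0; apply/eqP/row_matrixP => i; rewrite row0.
apply/eqP; apply: contraT => /(gram_pos g p).
have /sub_kermxP e : (row i (kermx (g p)) <= kermx (g p))%MS by exact: row_sub.
by rewrite /bilin e mul0mx mxE ltxx.
Qed.

Lemma form_in_unit p x : chart_img p x -> form_in g p x \in unitmx.
Proof.
move=> px; rewrite form_inE !unitmx_mul unitmx_tr gram_unit.
by rewrite jacobian_transition_unit//; exact: overlap_param.
Qed.

Lemma form_in_center p : form_in g p (chart p p) = g p.
Proof.
rewrite form_inE chartK; last exact: chart_dom_center.
by rewrite jacobian_self ?trmx1 ?mul1mx ?mulmx1//; exact: center_in.
Qed.

Lemma form_in_transition p q x : overlap p q x -> form_in g p x =
  'J (transition p q) x *m form_in g q (transition p q x)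
    *m ('J (transition p q) x)^T.
Proof.
move=> oq; apply: etrans (form_inE p x) _.
rewrite (form_inE q (transition p q x)).
rewrite (param_transition oq).
rewrite (jacobian_cocycle oq (overlap_param (overlap_img oq))).
by rewrite trmx_mul !mulmxA.
Qed.

(** On an overlap both Gram matrices represent the same metric, by the cocycle
rule for the Jacobians. *)
Lemma transition_isometry p q :
  local_conformal (overlap p q) (overlap q p) (form_in g p) (form_in g q)
    (transition p q) (fun=> 1).
Proof.
have sub p' q' : overlap p' q' `<=` chart_img p' by move=> x;
  exact: overlap_img.
split.
- exact: overlap_open.
- exact: overlap_open.
- by move=> x; exact: transition_ov.
- exact: transition_smooth.
- exact: smooth_cst.
- by move=> x _; exact: oner_neq0.
- by apply: smooth_subset (gram_smooth g p); exact: sub.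
- exact: form_in_sym.
- by move=> x /sub; exact: form_in_unit.
- by apply: smooth_subset (gram_smooth g q); exact: sub.
- exact: form_in_sym.
- by move=> x /sub; exact: form_in_unit.
- move=> x ox; rewrite expr1n scale1r (form_in_transition ox).
  have uA := jacobian_transition_unit ox; have uG :=
    form_in_unit (overlap_img (transition_ov ox)).
  by rewrite invmx_congruence// mulmxKV.
- move=> x ox; rewrite (_ : \row_i _ = 0) ?mul0mx//.
  by apply/rowP => i; rewrite !mxE /pd derive_cst.
Qed.

End Forms.
End Charts.

(** * Horizontal vectors at a point *)

Lemma posdef_eq0 (R : realType) n (G : 'M[R]_n) (v : 'rV[R]_n) :
  (forall u : 'rV[R]_n, u != 0 -> 0 < bilin G u u) -> bilin G v v = 0 -> v = 0.
Proof.
move=> Gpos v0; apply/eqP; apply: contraT => /Gpos.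
by rewrite v0 ltxx.
Qed.

Section PointwiseSubmersion.
Variables (R : realType) (n m : nat) (G : 'M[R]_n) (t : 'M[R]_(n, m)).
Hypothesis Gsym : G^T = G.
Hypothesis Gunit : G \in unitmx.
Hypothesis Gpos : forall u : 'rV[R]_n, u != 0 -> 0 < bilin G u u.
Hypothesis t_full : row_full t.
Local Notation N := (t^T *m invmx G).

Lemma bilin_lift (a : 'rV[R]_m) (v : 'rV[R]_n) : bilin G (a *m N) v =
  (a *m (v *m t)^T) 0 0.
Proof. by rewrite /bilin trmx_mul !mulmxA mulmxKV. Qed.

Lemma lift_horizontal (a : 'rV[R]_m) (v : 'rV[R]_n) :
  v *m t = 0 -> bilin G (a *m N) v = 0.
Proof. by move=> vt; rewrite bilin_lift vt trmx0 mulmx0 mxE. Qed.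

(** A row vector killed by the Gram matrix of the gradients gives a horizontal
vector of norm zero; surjectivity of [t] then makes the row itself zero. *)
Lemma lift_gram_unit : N *m t \in unitmx.
Proof.
rewrite -row_free_unit -kermx_eq0; apply/eqP/row_matrixP => i; rewrite row0.
set a := row i _.
have aS : a *m (N *m t) = 0.
  by apply/sub_kermxP; exact: row_sub.
have aN : a *m N = 0.
  by apply: (posdef_eq0 Gpos); rewrite bilin_lift -mulmxA aS trmx0 mulmx0 mxE.
have at0 : a *m t^T = 0 by rewrite -[t^T](mulmxKV Gunit) mulmxA aN mul0mx.
have tf : row_free t^T by rewrite /row_free mxrank_tr; exact: t_full.
by apply: (row_free_inj tf); rewrite at0 mul0mx.
Qed.

Lemma lift_gram_sym : (N *m t)^T = N *m t.
Proof. by rewrite !trmx_mul trmxK trmx_inv Gsym mulmxA. Qed.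

(** Subtract from [u] the combination of gradients with the same image: the
difference is vertical and orthogonal to every vertical vector, itself
included. *)
Lemma horizontal_lift (u : 'rV[R]_n) :
  (forall v : 'rV[R]_n, v *m t = 0 -> bilin G u v = 0) ->
  exists a : 'rV[R]_m, u = a *m N.
Proof.
move=> hu; pose a := u *m t *m invmx (N *m t); exists a.
pose v := u - a *m N.
have vt : v *m t = 0 by rewrite mulmxBl /a -[_ *m N *m t]mulmxA mulmxKV
  ?lift_gram_unit// subrr.
apply/eqP; rewrite -subr_eq0 -/v; apply/eqP/(posdef_eq0 Gpos).
rewrite {1}/v /bilin !mulmxBl entryD entryN.
rewrite -/(bilin G u v) -/(bilin G (a *m N) v) hu// lift_horizontal// subrr //.
Qed.

(** Tested on the rows of [N], conformality reads [S *m H *m S = c *: S] with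
[S = N *m t] invertible. *)
Lemma cometric_of_conformal (H : 'M[R]_m) (c : R) : H \in unitmx ->
  (forall u v : 'rV[R]_n,
    (forall w : 'rV[R]_n, w *m t = 0 -> bilin G u w = 0) ->
    (forall w : 'rV[R]_n, w *m t = 0 -> bilin G v w = 0) ->
    bilin H (u *m t) (v *m t) = c * bilin G u v) ->
  N *m t = c *: invmx H.
Proof.
move=> uH conf; set S := N *m t.
have uS : S \in unitmx by exact: lift_gram_unit.
have SHS : S *m H *m S = c *: S.
  apply/matrixP => i j.
  have := conf (delta_mx 0 i *m N) (delta_mx 0 j *m N)
    (lift_horizontal _) (lift_horizontal _).
  have entry (A : 'M[R]_m) :
      ((delta_mx 0 i : 'rV[R]_m) *m A *m (delta_mx 0 j : 'rV[R]_m)^T) 0 0 =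
        A i j.
    by rewrite -rowE trmx_delta -colE !mxE.
  rewrite bilin_lift /bilin -!(mulmxA _ N t) -/S trmx_mul lift_gram_sym -/S.
  have -> : delta_mx 0 i *m S *m H *m (S *m (delta_mx 0 j)^T) =
      delta_mx 0 i *m (S *m H *m S) *m (delta_mx 0 j)^T :> 'M[R]_1.
    by rewrite !mulmxA.
  by rewrite (mulmxA _ S (_^T)) !entry entryZ.
have : S *m H = c%:M.
  by apply: (can_inj (mulmxK uS)); rewrite SHS mul_scalar_mx.
move=> /(congr1 (mulmx^~ (invmx H))); rewrite mulmxK// => ->.
by rewrite mul_scalar_mx.
Qed.

End PointwiseSubmersion.

(** * The submersion read in charts *)

Section Submersion.
Variables (R : realType) (n m : nat) (M : manifold R n) (N : manifold R m).
Variables (g : metric M) (h : metric N) (theta : M -> N) (sigma : M -> R).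
Hypothesis conf : conformal_submersion g h theta sigma.
Hypothesis homo : homothetic g theta sigma.
Implicit Types p q : M.

Definition local_rep p : 'rV[R]_n -> 'rV[R]_m := chart (theta p) \o theta
  \o param p.
Definition rep_domain p : set 'rV[R]_n :=
  chart_img p `&` (theta \o param p) @^-1` chart_dom (theta p).

Let theta_smooth p : smooth_into (chart_img p) (theta \o param p).
Proof. by have [[+ _] _ _ _] := conf; exact. Qed.

Lemma rep_domain_open p : open (rep_domain p).
Proof.
apply: open_preimage; first exact: chart_img_open.
  exact: chart_dom_open.
exact: (theta_smooth p).1.
Qed.

Lemma rep_smooth p : smooth_on (rep_domain p) (local_rep p).
Proof. exact: (theta_smooth p).2. Qed.

Lemma rep_domain_img p x : rep_domain p x -> chart_img p x. Proof. by case. Qed.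

Lemma rep_domain_center p : rep_domain p (chart p p).
Proof.
split; first exact: center_in.
rewrite /= chartK; exact: chart_dom_center.
Qed.

Lemma rep_img p x : rep_domain p x -> chart_img (theta p) (local_rep p x).
Proof. by move=> [_ H]; exact: chart_in. Qed.

Lemma param_rep p x : rep_domain p x -> param (theta p) (local_rep p x) =
  theta (param p x).
Proof. by move=> [_ H]; rewrite /local_rep /= chartK. Qed.

Lemma rep_center q : local_rep q (chart q q) = chart (theta q) (theta q).
Proof. by rewrite /local_rep /= chartK//; exact: chart_dom_center. Qed.

Lemma rep_differentiable p x : rep_domain p x -> differentiable (local_rep p) x.
Proof. exact: smooth_differentiable (@rep_smooth p). Qed.

Definition rep_overlap p q : set 'rV[R]_n := rep_domain p `&` (overlap p q `&`
  transition p q @^-1` rep_domain q).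

Lemma rep_overlap_open p q : open (rep_overlap p q).
Proof.
apply: openI; first exact: rep_domain_open.
apply: open_preimage; [exact: overlap_open|exact: rep_domain_open|].
by move=> x ox; apply: differentiable_continuous;
  exact: transition_differentiable.
Qed.

Lemma rep_overlap_overlap p q : rep_overlap p q `<=` overlap p q. Proof.
by move=> x [_ []]. Qed.
Lemma rep_overlap_domain p q : rep_overlap p q `<=` rep_domain p. Proof.
by move=> x []. Qed.
Lemma rep_overlap_transition p q x : rep_overlap p q x ->
  rep_domain q (transition p q x). Proof. by move=> [_ []]. Qed.

Lemma rep_in_overlap p q x : rep_overlap p q x ->
  overlap (theta q) (theta p) (local_rep q (transition p q x)).
Proof.
move=> dx; apply: overlapP; first exact: rep_img (rep_overlap_transition dx).
rewrite (param_rep (rep_overlap_transition dx)) (param_transition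
  (rep_overlap_overlap dx)).
by have [_] := rep_overlap_domain dx.
Qed.

Lemma rep_transition p q x : rep_overlap p q x ->
  local_rep p x = transition (theta q) (theta p) (local_rep q (transition p q
    x)).
Proof.
move=> dx; rewrite /transition /= (param_rep (rep_overlap_transition dx))
  (param_transition (rep_overlap_overlap dx)).
by [].
Qed.

Lemma jacobian_rep p q x : rep_overlap p q x ->
  'J (local_rep p) x = 'J (transition p q) x *m 'J (local_rep q) (transition p q
    x)
    *m 'J (transition (theta q) (theta p)) (local_rep q (transition p q x)).
Proof.
move=> dx.
have d1 := transition_differentiable (rep_overlap_overlap dx).
have d2 := rep_differentiable (rep_overlap_transition dx).
have d3 := transition_differentiable (rep_in_overlap dx).
have d12 : differentiable (local_rep q \o transition p q) x by exact:
  differentiable_comp.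
rewrite -(jacobian_comp d1 d2).
apply: etrans (jacobian_comp d12 d3).
apply/esym; apply: (jacobian_eq (@rep_overlap_open p q) dx).
  by move=> y dy; rewrite (rep_transition dy).
exact: (differentiable_comp d12 d3).
Qed.

Lemma rep_overlap_param p x : rep_domain p x -> rep_overlap p (param p x) x.
Proof.
move=> dx; split => //; split; first exact: overlap_param (rep_domain_img dx).
exact: rep_domain_center.
Qed.

Lemma tmapE q : tmap theta q = 'J (local_rep q) (chart q q).
Proof. exact: erefl. Qed.

Lemma jacobian_rep_center p x : rep_domain p x -> let q := param p x in
  'J (local_rep p) x = 'J (transition p q) x *m tmap theta q
    *m 'J (transition (theta q) (theta p)) (chart (theta q) (theta q)).
Proof.
move=> dx q; have := jacobian_rep (rep_overlap_param dx).
by rewrite -rep_center.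
Qed.

Let t_full q : row_full (tmap theta q).
Proof. by have [[_ +] _ _ _] := conf; exact. Qed.

Lemma pointwise_cometric q :
  (tmap theta q)^T *m invmx (g q) *m tmap theta q
  = sigma q ^+ 2 *: invmx (h (theta q)).
Proof.
have [_ _ _ cf] := conf.
apply: (@cometric_of_conformal _ _ _ (g q)).
- exact: gram_sym.
- exact: gram_unit.
- exact: gram_pos.
- exact: t_full.
- exact: gram_unit.
- by move=> u v hu hv; exact: cf.
Qed.

(** The data of the submersion are given at each point in the charts centered
there and at its image; these factorizations carry them to the fixed charts at
[p] and [theta p]. *)
Lemma rep_factors p x : rep_domain p x -> let q := param p x in
  [/\ 'J (transition p q) x \in unitmx,
      'J (transition (theta q) (theta p)) (chart (theta q) (theta q))
        \in unitmx,
      form_in g p x = 'J (transition p q) x *m g q *m ('J (transition p q) x)^T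
        &
      form_in h (theta p) (local_rep p x) =
        invmx ('J (transition (theta q) (theta p)) (chart (theta q) (theta q)))
        *m h (theta q)
        *m (invmx ('J (transition (theta q) (theta p)) (chart (theta q)
          (theta q))))^T].
Proof.
move=> dx q; have dq := rep_overlap_param dx; have oq := rep_overlap_overlap dq.
have or := rep_in_overlap dq; have er := rep_transition dq.
have Ec : local_rep q (transition p q x) = chart (theta q) (theta q) by rewrite
  -rep_center.
rewrite -/q Ec in or; rewrite -/q Ec in er.
have uB := jacobian_transition_unit or.
split.
- exact: jacobian_transition_unit oq.
- exact: uB.
- exact: form_inE.
have := form_in_transition h or; rewrite form_in_center -er => ->.
by rewrite trmx_inv !mulmxA mulVmx// mul1mx mulmxK// unitmx_tr.
Qed.

Lemma sigma_gradient p q x : overlap p q x ->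
  \row_i pd i (sigma \o param p) x
  = (\row_i pd i (sigma \o param q) (transition p q x))
    *m ('J (transition p q) x)^T.
Proof.
move=> oq; have [_ Ss _ _] := conf.
rewrite -(gradient_comp (@transition_smooth _ _ _ p q) (Ss q) oq (overlap_img
  (transition_ov oq))).
apply/rowP => i; rewrite !mxE; apply: near_eq_derive.
apply: (open_eq_near (@overlap_open _ _ _ p q) oq) => y oy /=.
by rewrite (param_transition oy).
Qed.

Lemma rep_conformal p : local_conformal (rep_domain p) (chart_img (theta p))
  (form_in g p) (form_in h (theta p)) (local_rep p) (sigma \o param p).
Proof.
have sub : rep_domain p `<=` chart_img p by move=> x; exact: rep_domain_img.
have [_ Ss s0 _] := conf.
split.
- exact: rep_domain_open.
- exact: chart_img_open.
- exact: rep_img.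
- exact: rep_smooth.
- by apply: smooth_subset (Ss p); exact: sub.
- by move=> x _ /=; rewrite gt_eqF.
- by apply: smooth_subset (gram_smooth g p); exact: sub.
- exact: form_in_sym.
- by move=> x /sub; exact: form_in_unit.
- exact: gram_smooth.
- exact: form_in_sym.
- exact: form_in_unit.
- move=> x dx; have [uA uB Eg Eh] := rep_factors dx.
  rewrite Eg Eh (jacobian_rep_center dx) /=.
  set q := param p x in uA uB *; set A := 'J _ x in uA *.
  set B := 'J _ (chart _ _) in uB *; set t := tmap theta q.
  have uBi : invmx B \in unitmx by rewrite unitmx_inv.
  have -> : invmx (invmx B *m h (theta q) *m (invmx B)^T) =
     B^T *m invmx (h (theta q)) *m B.
    have := invmx_congruence uBi (gram_unit h (theta q)).
    rewrite invmxK => /(congr1 (mulmx B^T)).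
    by rewrite !mulmxA -trmx_mul mulVmx// trmx1 mul1mx.
  have EK := invmx_congruence uA (gram_unit g q); set K := invmx _ in EK *.
  rewrite !trmx_mul -!mulmxA (mulmxA A^T) EK -!mulmxA mulKmx//.
  have Pt := pointwise_cometric q; rewrite -/t in Pt.
  rewrite (mulmxA _ t) (mulmxA t^T _ B) (mulmxA t^T) Pt.
  by rewrite -scalemxAl -scalemxAr.
- move=> x dx; have [uA uB Eg Eh] := rep_factors dx.
  rewrite Eg (jacobian_rep_center dx) (sigma_gradient (rep_overlap_overlap
    (rep_overlap_param dx))).
  set q := param p x in uA uB *; set A := 'J _ x in uA *.
  have EK := invmx_congruence uA (gram_unit g q); set K := invmx _ in EK *.
  rewrite -!mulmxA (mulmxA A^T) EK -!mulmxA mulKmx// !mulmxA.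
  have := homo q; rewrite /vertical /grad => ->.
  by rewrite mul0mx.
Qed.

End Submersion.

(** * The conditions on the fibers and on the horizontal distribution *)

Lemma derive_dir (R : realType) n a b (A : 'rV[R]_n -> 'M[R]_(a, b)) x v :
  differentiable A x -> 'D_v A x = \sum_i v 0 i *: partial i A x.
Proof.
move=> dA; rewrite deriveE// {1}(row_sum_delta v) linear_sum.
by apply: eq_bigr => i _; rewrite linearZ partialE deriveE.
Qed.

Section SubmersionForms.
Variables (R : realType) (n m : nat) (M : manifold R n) (N : manifold R m).
Variables (g : metric M) (h : metric N) (theta : M -> N) (sigma : M -> R).
Hypothesis conf : conformal_submersion g h theta sigma.
Hypothesis homo : homothetic g theta sigma.
Implicit Types p q : M.

Let lc p := rep_conformal conf homo p.

Section Fibers.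
Hypothesis fib : totally_geodesic_fibers g theta.
Variable q : M.
Local Notation G := (form_in g q).
Local Notation th := (local_rep theta q).
Local Notation lift := (hlift G th).

(** The projection of the constant field [w] to the vertical spaces along the
horizontal ones, which extends a vertical vector to a smooth vertical field.
*)
Definition vertical_ext (w x : 'rV[R]_n) : 'rV[R]_n :=
  w - w *m 'J th x *m invmx (lift x *m 'J th x) *m lift x.

Lemma lift_jacobian_unit x : rep_domain theta q x -> lift x *m 'J th x
  \in unitmx.
Proof.
move=> dx; rewrite (lift_jacobian (lc q))//.
rewrite unitmxZ.
  by rewrite unitmx_inv; apply: (lc_Hunit (lc q)); exact: rep_img.
by rewrite unitrX// unitfE; exact: (lc_s_neq0 (lc q)).
Qed.

Let od : open (rep_domain theta q). Proof. exact: rep_domain_open conf q. Qed.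

Let Sth : smooth_on (rep_domain theta q) th. Proof. exact: rep_smooth conf q.
Qed.

Lemma vertical_ext_smooth w : smooth_on (rep_domain theta q) (vertical_ext w).
Proof.
have ST := jacobian_smooth od Sth.
have SL := lift_smooth (lc q).
have SLT := smooth_mulmx od SL ST.
have SI := smooth_invmx od lift_jacobian_unit SLT.
have Sw : smooth_on (rep_domain theta q) (fun=> w) by exact: smooth_cst.
have S1 := smooth_mulmx od (smooth_mulmx od (smooth_mulmx od Sw ST) SI) SL.
have Sm1 : smooth_on (rep_domain theta q) (fun=> (-1 : R)) by exact: smooth_cst.
apply: (smooth_eq od _ (smoothD od Sw (smooth_scalemx od Sm1 S1))) => x _ /=.
by rewrite scaleN1r.
Qed.

Lemma vertical_ext_vertical w x : rep_domain theta q x ->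
  vertical_ext w x *m 'J th x = 0.
Proof.
move=> dx; rewrite /vertical_ext mulmxBl -[X in _ - X]mulmxA mulmxKV ?subrr//.
exact: lift_jacobian_unit.
Qed.

Lemma vertical_ext_id w x : w *m 'J th x = 0 -> vertical_ext w x = w.
Proof. by move=> wt; rewrite /vertical_ext wt !mul0mx subr0. Qed.

Definition vertical_field (w : 'rV[R]_n) : vfield M :=
  fun r => vertical_ext w (chart q r) *m 'J (transition q r) (chart q r).

Definition rep_nbhd : set M := chart_dom q `&` chart q @^-1` rep_domain theta q.

Lemma rep_nbhd_open : open rep_nbhd.
Proof.
apply: open_preimage; [exact: chart_dom_open|exact: od|].
exact: chart_continuous.
Qed.

Lemma vf_in_vertical_field w p y : chart_img p y -> rep_nbhd (param p y) ->
  vf_in (vertical_field w) p y =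
  vertical_ext w (transition p q y) *m 'J (transition q p) (transition p q y).
Proof.
move=> py [qr _]; rewrite /vf_in /vertical_field; set r := param p y.
have e : transition p q y = chart q r by [].
have [pr er] := chart_img_param py.
have o1 : overlap q r (chart q r).
  by apply: overlapP; [exact: chart_in|rewrite chartK//;
    exact: chart_dom_center].
have o2 : overlap q p (chart q r).
  by apply: overlapP; [exact: chart_in|rewrite chartK].
rewrite e (jacobian_cocycle o1 o2) mulmxA; congr (_ *m 'J _ _).
by rewrite /transition /= chartK.
Qed.

(** In any chart the field is the composite of [vertical_ext] and a transition
map, multiplied by the Jacobian of the inverse transition. *)
Lemma vertical_field_smooth w : smooth_vf_on rep_nbhd (vertical_field w).
Proof.
move=> p.
have oI := image_dom_open (p := p) rep_nbhd_open.
have inI y : (chart p @` (rep_nbhd `&` chart_dom p)) y ->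
    [/\ chart_img p y, rep_nbhd (param p y), overlap p q y &
      rep_domain theta q (transition p q y)].
  move=> [r [[qr rep_domain] pr] <-]; split.
  - exact: chart_in.
  - by rewrite chartK.
  - by apply: overlapP; [exact: chart_in|rewrite chartK].
  - by rewrite /transition /= chartK.
have od' : open (rep_domain theta q `&` overlap q p) by apply: openI => //;
  exact: overlap_open.
have Sf : smooth_on (rep_domain theta q `&` overlap q p)
    (fun x => vertical_ext w x *m 'J (transition q p) x).
  apply: smooth_mulmx => //.
    by apply: smooth_subset (vertical_ext_smooth w) => x [].
  apply: smooth_subset (jacobian_smooth (@overlap_open _ _ _ q p)
    (@transition_smooth _ _ _ q p)).
  by move=> x [].
have St : smooth_on (chart p @` (rep_nbhd `&` chart_dom p)) (transition p q).
  by apply: smooth_subset (@transition_smooth _ _ _ p q) => y /inI[].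
apply: (smooth_eq oI _ (smooth_comp oI od' _ St Sf)).
  by move=> y /inI[py ry oy dy]; rewrite vf_in_vertical_field.
by move=> y /inI[py ry oy dy]; split => //; exact: transition_ov.
Qed.

Lemma vertical_field_vertical w r : rep_nbhd r ->
  vertical theta r (vertical_field w r).
Proof.
move=> [qr dx]; rewrite /vertical /vertical_field; set x := chart q r.
have er : param q x = r by rewrite chartK.
have := vertical_ext_vertical w dx.
rewrite (jacobian_rep_center conf dx) /= -/x er !mulmxA => e.
have [_ uB _ _] := rep_factors g h dx; rewrite -/x er in uB.
by rewrite -[LHS](mulmxK uB) e mul0mx.
Qed.

Lemma nabla_center (X Y : vfield M) : differentiable (vf_in Y q) (chart q q) ->
  nabla g X Y q = \sum_i X q 0 i *: (partial i (vf_in Y q) (chart q q)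
    + Y q *m conn G i (chart q q)).
Proof.
move=> dY; rewrite /nabla derive_dir//.
under [RHS]eq_bigr do rewrite scalerDr.
rewrite big_split; congr (_ + _).
apply/rowP => k; rewrite mxE summxE; apply: eq_bigr => i _.
rewrite entryZ mxE mulr_sumr; apply: eq_bigr => j _.
rewrite connE; move: (christoffel _ _ _ _ _) (X q 0 i) (Y q 0 j) => c a b.
by rewrite -mulrA mulrCA [c * b]mulrC.
Qed.

(** Differentiating [V *m 'J theta = 0] for a vertical field [V] shows that
the image of [nabla U V] in the base is minus the Hessian of [theta] on [U]
and [V]. *)
Lemma fibers_center (u v : 'rV[R]_n) :
  u *m 'J th (chart q q) = 0 -> v *m 'J th (chart q q) = 0 ->
  v *m along (fun i => hess G th i (chart q q)) u = 0.
Proof.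
set x := chart q q => uT vT.
have dx : rep_domain theta q x by exact: rep_domain_center.
have qq : chart_dom q q by exact: chart_dom_center.
have dq : rep_nbhd q by split.
have fq w : w *m 'J th x = 0 -> vertical_field w q = w.
  move=> wT; rewrite /vertical_field vertical_ext_id// jacobian_self ?mulmx1//.
  exact: center_in.
have := fib rep_nbhd_open (vertical_field_smooth u) (vertical_field_smooth v)
  (@vertical_field_vertical u) (@vertical_field_vertical v) dq.
have Ev y : rep_domain theta q y -> vertical_ext v y =
  vf_in (vertical_field v) q y.
  move=> dy; have py := rep_domain_img dy; have [qy ey] := chart_img_param py.
  rewrite vf_in_vertical_field//; last by split => //=; rewrite ey.
  have -> : transition q q y = y by rewrite /transition /= ey.
  by rewrite jacobian_self// mulmx1.
have Sv := vertical_ext_smooth v.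
have dv : differentiable (vf_in (vertical_field v) q) x.
  have S := smooth_eq od Ev Sv; exact: smooth_differentiable S dx.
rewrite nabla_center// (fq u uT) (fq v vT) /vertical tmapE -/x => e.
have ST := jacobian_smooth od Sth.
have e2 i : partial i (vertical_ext v) x *m 'J th x
    + v *m partial i (fun y => 'J th y) x = 0.
  rewrite -{2}(vertical_ext_id vT) -(partial_mul i Sv ST dx).
  rewrite (partial_eq od i dx (B := fun=> 0));
    last exact: vertical_ext_vertical.
  by rewrite partialE derive_cst.
apply: oppr_inj; rewrite oppr0 -[RHS]e mulmx_suml /along mulmx_sumr -sumrN.
apply: eq_bigr => i _; rewrite -scalemxAr -scalemxAl -scalerN; congr (_ *: _).
rewrite -(partial_eq od i dx Ev) mulmxDl.
have -> : partial i (vertical_ext v) x *m 'J th x =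
  - (v *m partial i (fun y => 'J th y) x).
  by apply/eqP; rewrite -addr_eq0; apply/eqP; exact: e2.
rewrite hess.unlock mulmxBr !mulmxA opprB addrC; exact: erefl.
Qed.

End Fibers.

Lemma rep_fibers (fib : totally_geodesic_fibers g theta) p x (u v : 'rV[R]_n) :
  rep_domain theta p x -> u *m 'J (local_rep theta p) x = 0 ->
    v *m 'J (local_rep theta p) x = 0 ->
  v *m along (fun i => hess (form_in g p) (local_rep theta p) i x) u = 0.
Proof.
move=> dx uT vT; pose q := param p x.
have d2 : rep_overlap theta p q x := rep_overlap_param dx.
have oq := rep_overlap_overlap d2.
have oU := rep_overlap_open conf (p := p) (q := q).
have oV : open (rep_domain theta q) := rep_domain_open conf (p := q).
have Srep : smooth_on (rep_domain theta q) (local_rep theta q) :=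
  rep_smooth conf q.
pose B y := 'J (transition (theta q) (theta p)) (local_rep theta q (transition p
  q y)).
have Str : smooth_on (rep_overlap theta p q) (transition p q).
  by apply: smooth_subset (@transition_smooth _ _ _ p q);
    exact: rep_overlap_overlap.
have SB : smooth_on (rep_overlap theta p q) B.
  have SJ := jacobian_smooth (@overlap_open _ _ _ (theta q) (theta p))
    (@transition_smooth _ _ _ (theta q) (theta p)).
  have S2 := smooth_comp oU oV (@rep_overlap_transition _ _ _ _ _ theta p q) Str
    Srep.
  apply: (smooth_comp oU (@overlap_open _ _ _ (theta q) (theta p)) _ S2 SJ).
  by move=> y dy; exact: rep_in_overlap.
have JE y : rep_overlap theta p q y -> 'J (local_rep theta p) y =
    'J (transition p q) y *m 'J (local_rep theta q) (transition p q y) *m B y.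
  move=> dy.
  have e := jacobian_rep conf dy.
  exact: e.
have uB : B x \in unitmx by apply: jacobian_transition_unit;
  exact: rep_in_overlap.
have vert (w : 'rV[R]_n) : w *m 'J (local_rep theta p) x = 0 ->
    w *m 'J (transition p q) x *m 'J (local_rep theta q) (transition p q x) = 0.
  rewrite (JE x d2) !mulmxA => e.
  by rewrite -[LHS](mulmxK uB) e mul0mx.
have Jtr y : overlap p q y -> 'J (transition p q) y \in unitmx :=
  @jacobian_transition_unit _ _ _ p q y.
rewrite (hess_change (transition_isometry g p q) Jtr oU oV (@rep_overlap_overlap
  _ _ _ _ _ theta p q)
  (@rep_overlap_transition _ _ _ _ _ theta p q) Srep SB JE u d2 (vert v vT)).
have -> : transition p q x = chart q q by [].
rewrite (fibers_center fib); first exact: mul0mx.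
- exact: vert.
- exact: vert.
Qed.

(** The integral manifold through the point, read in the chart at [p],
satisfies the hypotheses of [integrable_mixed]. *)
Lemma rep_integrable (horint : horizontal_integrable g theta) p x (v : 'rV[R]_n)
  :
  rep_domain theta p x -> v *m 'J (local_rep theta p) x = 0 ->
  let D := along (fun i => hess (form_in g p) (local_rep theta p) i x) v in
  (hlift (form_in g p) (local_rep theta p) x *m D)^T =
  hlift (form_in g p) (local_rep theta p) x *m D.
Proof.
move=> dx vT.
have [W [F [oW [cF sF] [w Ww Fw] hF]]] := horint (param p x).
have [px ex] := chart_img_param (rep_domain_img dx).
pose W' := W `&` F @^-1` rep_nbhd p.
have oW' : open W' by apply: open_preimage => //; exact: rep_nbhd_open.
pose W1 := W `&` F @^-1` chart_dom p.
have oW1 : open W1 by apply: open_preimage => //; exact: chart_dom_open.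
pose Fh := chart p \o F.
have SF1 : smooth_on W1 Fh by exact: sF.
have SF : smooth_on W' Fh by apply: smooth_subset SF1 => y [Wy [py _]].
have Fd y : W' y -> rep_domain theta p (Fh y) by move=> [_ []].
have Fhw : Fh w = x by rewrite /Fh /= Fw.
have W'w : W' w.
  by split => //; rewrite /= Fw; split => //; rewrite /= ex.
have ST := jacobian_smooth (rep_domain_open conf (p := p)) (rep_smooth conf p).
have SL := lift_smooth (lc p).
have od : open (rep_domain theta p) := rep_domain_open conf (p := p).
pose S y := hlift (form_in g p) (local_rep theta p) y *m 'J (local_rep theta p)
  y.
have uS y : rep_domain theta p y -> S y \in unitmx by exact: lift_jacobian_unit.
have SSi : smooth_on (rep_domain theta p) (fun y => 'J (local_rep theta p) y
  *m invmx (S y)).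
  apply: smooth_mulmx => //; apply: smooth_invmx => //.
  exact: smooth_mulmx.
(* The coefficients of the rows of 'J Fh on the gradients of the components of
   theta, recovered from their images in the base; in this form they are
   smooth. *)
pose K y := 'J Fh y *m ('J (local_rep theta p) (Fh y) *m invmx (S (Fh y))).
have SK : smooth_on W' K.
  apply: smooth_mulmx => //; first exact: jacobian_smooth.
  exact: (smooth_comp oW' od Fd SF SSi).
have chain y : W' y -> 'J (chart (F y) \o F) y =
    'J Fh y *m 'J (transition p (F y)) (Fh y).
  move=> [Wy [py dy]].
  have W1y : W1 y by split.
  have oy : overlap p (F y) (Fh y).
    apply: overlapP; first exact: chart_in.
    by rewrite /Fh /= chartK//; exact: chart_dom_center.
  have d1 : differentiable Fh y by exact: smooth_differentiable SF1 W1y.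
  have d2 := transition_differentiable oy.
  rewrite -(jacobian_comp d1 d2); apply/esym; apply: (jacobian_eq oW1 W1y).
    by move=> z [_ pz]; rewrite /transition /Fh /= chartK.
  exact: differentiable_comp.
have JF y : W' y -> 'J Fh y = K y *m hlift (form_in g p) (local_rep theta p)
  (Fh y).
  move=> W'y; have [Wy [py dy]] := W'y.
  have er : param p (Fh y) = F y by rewrite /Fh /= chartK.
  have [uA uB Eg _] := rep_factors g h dy.
  have Jr := jacobian_rep_center conf dy.
  rewrite /= er in uA uB Eg Jr.
  have := chain y W'y; have [_ hor] := hF y Wy.
  set Dr := 'J (chart (F y) \o F) y in hor *; set D := 'J Fh y.
  set A := 'J (transition p (F y)) (Fh y) in uA Eg Jr *.
  set B := 'J (transition (theta (F y)) (theta p)) _ in uB Jr.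
  set t := tmap theta (F y) in Jr.
  move=> EDr.
  have [X EX] : exists X, Dr = X *m (t^T *m invmx (g (F y))).
    have ex_row i : exists a : 'rV[R]_m, row i Dr =
      a *m (t^T *m invmx (g (F y))).
      apply: horizontal_lift.
      - exact: gram_unit.
      - exact: gram_pos.
      - by have [[_ tf] _ _ _] := conf; exact: tf.
      apply/hor; exists (delta_mx 0 i); exact: rowE.
    exists (\matrix_i projT1 (cid (ex_row i))).
    apply/row_matrixP => i; rewrite row_mul rowK.
    exact: projT2 (cid (ex_row i)).
  have EL : hlift (form_in g p) (local_rep theta p) (Fh y) =
      B^T *m (t^T *m invmx (g (F y))) *m invmx A.
    have EK := invmx_congruence uA (gram_unit g (F y)).
    rewrite liftE Jr Eg; set Q := invmx (A *m _ *m _) in EK *.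
    by rewrite !trmx_mul -!mulmxA EK.
  have ED : D = X *m invmx B^T *m hlift (form_in g p) (local_rep theta p)
    (Fh y).
    have uBt : B^T \in unitmx by rewrite unitmx_tr.
    rewrite EL -(mulmxA B^T) (mulmxA _ B^T) -(mulmxA X) (mulVmx uBt) mulmx1.
    rewrite (mulmxA X) -EX EDr; exact: esym (mulmxK uA _).
  have uSy : S (Fh y) \in unitmx by exact: uS.
  have cancel (L : 'M[R]_(m, n)) (T : 'M[R]_(n, m)) (Y : 'M[R]_m) :
      L *m T \in unitmx ->
      Y *m L *m (T *m invmx (L *m T)) *m L = Y *m L.
    by move=> uLT; rewrite -(mulmxA Y) (mulmxA L) (mulmxV uLT) mulmx1.
  rewrite /K -/D; apply: (etrans ED); rewrite [in RHS]ED.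
  exact: esym (cancel _ _ _ uSy).
have uK : K w \in unitmx.
  rewrite -row_free_unit; apply/eqP/anti_leq; rewrite rank_leq_row /=.
  have [fr _] := hF w Ww.
  move: fr; rewrite (chain w W'w) /row_free => /eqP {1}<-.
  apply: leq_trans (mxrankM_maxl _ _) _; rewrite (JF w W'w).
  exact: mxrankM_maxl.
have := integrable_mixed (lc p) oW' W'w SF SK Fd JF uK (v := v).
by rewrite Fhw; exact.
Qed.

End SubmersionForms.

(** * The Ricci tensor on horizontal vectors *)

Lemma ricci_ricci_mx (R : realType) n (M : manifold R n) (g : metric M) (p : M)
  :
  ricci g p = ricci_mx (form_in g p) (chart p p).
Proof.
apply/matrixP => j k; rewrite !mxE; apply: eq_bigr => i _.
have oc := @chart_img_open _ _ M p.
apply: (riemann_curvature oc (gram_smooth g p)).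
- by move=> x; exact: form_in_unit.
- exact: center_in.
Qed.

Section Main.
Variables (R : realType) (n m : nat) (M : manifold R n) (N : manifold R m).
Variables (g : metric M) (h : metric N) (theta : M -> N) (sigma : M -> R).
Hypothesis conf : conformal_submersion g h theta sigma.
Hypothesis homo : homothetic g theta sigma.

Definition laplacian_log (p : M) : R :=
  log_laplacian (form_in g p) (sigma \o param p) (chart p p).

Lemma laplacian_log_chart (p : M) x : chart_img p x ->
  laplacian_log (param p x) = log_laplacian (form_in g p) (sigma \o param p) x.
Proof.
move=> px; set q := param p x; have [_ Ss s0 _] := conf.
have oq : overlap p q x by exact: overlap_param.
apply: esym.
have Jtr y : overlap p q y -> 'J (transition p q) y \in unitmx :=
  @jacobian_transition_unit _ _ _ p q y.
apply: (log_laplacian_isometry (transition_isometry g p q) Jtr _ _ _ _ oq).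
- by apply: smooth_subset (Ss p) => y; exact: overlap_img.
- by apply: smooth_subset (Ss q) => y; exact: overlap_img.
- by move=> y _ /=; rewrite gt_eqF.
- by move=> y oy /=; rewrite (param_transition oy).
Qed.

(** Near a point the values, each computed in the chart centered at its
argument, agree with the Laplacian computed in a single chart. *)
Lemma laplacian_log_smooth : smooth_fun laplacian_log.
Proof.
move=> p; have [_ Ss s0 _] := conf.
have oc := @chart_img_open _ _ M p.
have e x : chart_img p x ->
    log_laplacian (form_in g p) (sigma \o param p) x =
      (laplacian_log \o param p) x.
  by move=> px; rewrite /= laplacian_log_chart.
apply: (smooth_eq oc e).
apply: (log_laplacian_smooth oc (Ss p) (gram_smooth g p)).
- by move=> y _ /=; rewrite gt_eqF.
- by move=> y; exact: form_in_unit.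
Qed.

Hypothesis fib : totally_geodesic_fibers g theta.
Hypothesis horint : horizontal_integrable g theta.

(** The vector [v] is a combination of gradients of components of [theta], so
[lift_ricci_mx] applies. *)
Lemma ricci_horizontal (lambda : R) (p : M) (u v : 'rV[R]_n) :
  (forall q : N, ricci h q = lambda *: h q) ->
  horizontal g theta p v ->
  bilin (ricci g p) u v =
  (laplacian_log p + lambda * sigma p ^+ 2) * bilin (g p) u v.
Proof.
move=> ein hv; set x := chart p p.
have dx : rep_domain theta p x by exact: rep_domain_center.
have hessE y : rep_domain theta p y ->
  forall i, hess (form_in g p) (local_rep theta p) i y =
    model_hess (form_in h (theta p)) (local_rep theta p) (sigma \o param p) i y.
  move=> dy; apply: (hess_eq_model (rep_conformal conf homo p) dy).
  - by move=> a b aT bT; exact: rep_fibers conf homo fib _ _ _ _ dy aT bT.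
  - by move=> a aT; exact: rep_integrable conf homo horint _ _ _ dy aT.
have HE : ricci_mx (form_in h (theta p)) (local_rep theta p x) =
    lambda *: form_in h (theta p) (local_rep theta p x).
  by rewrite rep_center -ricci_ricci_mx ein form_in_center.
have := lift_ricci_mx (rep_conformal conf homo p) hessE dx HE.
rewrite -/(laplacian_log p) -ricci_ricci_mx liftE form_in_center -tmapE.
rewrite /= chartK; last exact: chart_dom_center.
set t := tmap theta p => E.
have [a ->] : exists a : 'rV[R]_m, v = a *m (t^T *m invmx (g p)).
  apply: horizontal_lift.
  - exact: gram_unit.
  - exact: gram_pos.
  - by have [[_ tf] _ _ _] := conf; exact: tf.
  - by move=> w wt; exact: hv.
have gt : g p *m (t^T *m invmx (g p))^T = t.
  by rewrite trmx_mul trmxK trmx_inv gram_sym mulmxA mulmxV ?mul1mx ?gram_unit.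
have Et : ricci g p *m (t^T *m invmx (g p))^T =
    (laplacian_log p + lambda * sigma p ^+ 2) *: t.
  by apply: trmx_inj; rewrite trmx_mul trmxK E trmxZ.
rewrite /bilin trmx_mul -!(mulmxA u) (mulmxA (ricci g p)) Et (mulmxA (g p)) gt.
by rewrite -scalemxAl -scalemxAr entryZ.
Qed.

End Main.

Unset Implicit Arguments.

Theorem theorem8 (R : realType) (d1 d2 : nat)
    (M1 : manifold R d1) (M2 : manifold R d2)
    (g1 : metric M1) (g2 : metric M2)
    (J : set R) (zeta : R -> M1) (xi : vfield M1) (mu : R)
    (theta : M1 -> M2) (sigma beta : M1 -> R)
    (zeta_geodesic : geodesic g1 J zeta)
    (xi_velocity : forall s, J s -> xi (zeta s) = velocity zeta s)
    (soliton : ricci_soliton g1 xi mu)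
    (theta_conformal : conformal_submersion g1 g2 theta sigma)
    (theta_homothetic : homothetic g1 theta sigma)
    (beta_smooth : smooth_fun beta)
    (theta_clairaut : clairaut g1 theta (fun p => expR (beta p)))
    (M2_einstein : einstein g2)
    (fibers_geodesic : totally_geodesic_fibers g1 theta)
    (hor_integrable : horizontal_integrable g1 theta) :
  conformal_on_horizontal g1 theta xi.
Proof.
have [lambda ein] := M2_einstein; have [_ sol] := soliton.
have [_ Ss _ _] := theta_conformal.
pose f p := - (laplacian_log g1 sigma p + lambda * sigma p ^+ 2 + mu).
exists f; split.
  move=> p; have oc := @chart_img_open _ _ M1 p.
  have SL := laplacian_log_smooth theta_conformal p.
  have Sc (c : R) : smooth_on (chart_img p) (fun=> c) by exact: smooth_cst.
  have S1 := smoothM oc (Sc lambda) (smoothM oc (Ss p) (Ss p)).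
  apply: (smooth_eq oc _ (smoothN oc (smoothD oc (smoothD oc SL S1) (Sc mu)))).
  by move=> x _; rewrite /f /= expr2.
move=> X1 X2 _ _ h1 h2 p.
have Lie : lie_metric xi g1 p = (- 2) *: ricci g1 p + (- 2 * mu) *: g1 p.
  have e := sol p; apply: (@scalerI _ _ (2^-1 : R)); first by rewrite invr_eq0.
  apply/eqP; rewrite -subr_eq0 -[X in _ == X]e; apply/eqP.
  move: (lie_metric xi g1 p) (ricci g1 p) (g1 p : 'M[R]_d1) => L Q G.
  by apply/matrixP => i j; rewrite !entryE; field.
have bilE (A B : 'M[R]_d1) (a b : R) u v :
    bilin (a *: A + b *: B) u v = a * bilin A u v + b * bilin B u v.
  by rewrite /bilin mulmxDr mulmxDl -!scalemxAr -!scalemxAl entryD !entryZ.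
rewrite Lie bilE (ricci_horizontal theta_conformal theta_homothetic fibers_geodesic
  hor_integrable _ ein (h2 p)) /f.
move: (bilin _ _ _) (laplacian_log _ _ _) (sigma p) => B L s.
by ring.
Qed.
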